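(* Let $h,N\in\mathbb{N}$ satisfy $1\leq h\leq 2N^2$ and write $\Delta=h-N^2$. Then for every $\varepsilon>0$, \[ T(h,N)=\Big(\frac{8}{\zeta(2)}-4\Big)\Big(\sum_{d\mid h}\frac1d\Big)N^2+O_\varepsilon\big(N^{1+\varepsilon}+N^{\varepsilon}|\Delta|\big). \]
   Context: For $h,N\in\mathbb{N}$, $T(h,N)=|\{(x_1,x_2,x_3,x_4)\in\mathbb{Z}^4: x_1x_4-x_2x_3=h,\ x_i\in[-N,N]\ \text{for all } i\}|$. $\zeta$ is the Riemann zeta function. *)

(* Defs.v *)
From HB Require Import structures.
From mathcomp Require Import all_boot all_order all_algebra.
From mathcomp Require Import finmap.
From mathcomp Require Import all_classical all_reals all_analysis.

Set Implicit Arguments.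
Unset Strict Implicit.
Unset Printing Implicit Defensive.

Import Order.TTheory GRing.Theory Num.Theory.
Import numFieldNormedType.Exports.

Local Open Scope classical_set_scope.
Local Open Scope ring_scope.

(* The tuple (x1, x2, x3, x4) is the matrix with rows (x1, x2) and (x3, x4). *)
Definition det_solutions (h N : nat) : set (int * int * int * int) :=
  [set x | let: (x1, x2, x3, x4) := x in
     [/\ x1 * x4 - x2 * x3 = h%:Z,
         (- N%:Z <= x1 <= N%:Z), (- N%:Z <= x2 <= N%:Z),
         (- N%:Z <= x3 <= N%:Z) & (- N%:Z <= x4 <= N%:Z)]].

(* fset_set is only meaningful on finite sets. *)
Lemma finite_det_solutions (h N : nat) : finite_set (det_solutions h N).
Proof.
pose I := [set x : int | - N%:Z <= x <= N%:Z].
have fI : finite_set I.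
  apply: (@sub_finite_set _ _ ((fun k : nat => k%:Z - N%:Z) @` `I_(N + N).+1)).
    move=> x /= /andP[lx ux]; exists `|(x + N%:Z)%R|%N.
      by rewrite ltnS -lez_nat gez0_abs ?PoszD ?lerD2r // -lerBlDr sub0r.
    by rewrite gez0_abs ?addrK // -lerBlDr sub0r.
  exact/finite_image/finite_II.
apply: (@sub_finite_set _ _ (I `*` I `*` I `*` I)).
  by move=> [[[x1 x2] x3] x4] [].
by do 3!apply: finite_setX => //.
Qed.

Definition T (h N : nat) : nat := #|` fset_set (det_solutions h N) |.

(* Dirichlet series of the Riemann zeta function on the real half-line s > 1,
   where it converges. *)
Definition zeta (R : realType) (s : R) : R :=
  limn (series (riemannR s)).

(* Main.v *)
(** Two vectors v, w of determinant h span exactly one sublattice L of index h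
in Z^2, and there are sigma(h) such sublattices.  Choose M with
M^2 < h <= (M+1)^2.  In the box of radius M a given L has no, one or two pairs
+-v of primitive vectors: two independent ones have determinant +-h because
2 M^2 < 2 h, and a third pair would be +-(v+w) or +-(v-w), which is excluded
since a hexagon with vertices +-v, +-w, +-(v+w) inside the box forces h <= M^2.
Hence L contributes 2p - 4 bases whenever it has p > 0 primitive vectors in the
box, and by Minkowski's pigeonhole argument p > 0 in the box of radius M+1.
Summing over L, T(h, M) = 2 W - 4 sigma(h) up to replacing M by M+1 in W, where
W = sum_{g | h} g #{coprime pairs in the box of radius M/g} counts the pairs
(v, L) and is (4/zeta(2)) M^2 sum_{g | h} 1/g up to O(h^eps M^(1+eps)).
Finally, changing the radius of the box by one changes T(h, .) by at most
O(M h^eps), which moves M to N at the cost of h^eps |M^2 - N^2|. *)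
Require Import Defs.
From mathcomp Require Import all_boot all_order all_algebra.
From mathcomp Require Import finmap.
From mathcomp Require Import all_classical all_reals all_analysis.
From mathcomp Require Import zify ring lra.

Import Order.TTheory GRing.Theory Num.Theory.
Import numFieldNormedType.Exports.
Local Open Scope ring_scope.

(** * The Moebius function and congruence counts *)

Definition mobius (n : nat) : int :=
  if all (fun p => logn p n == 1)%N (primes n) then (-1) ^+ size (primes n)
  else 0.

Lemma normr_mobius_le1 n : `|mobius n| <= 1.
Proof. by rewrite /mobius; case: ifP; rewrite ?normr0 // normrX normrN1 expr1n. Qed.

Lemma mobius_primeM p d : prime p -> (0 < d)%N -> ~~ (p %| d)%N ->
  mobius (p * d) = - mobius d.
Proof.
move=> pp d0 pd; have p0 := prime_gt0 pp.
have pE : perm_eq (primes (p * d)) (p :: primes d).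
  apply: uniq_perm; rewrite ?primes_uniq //=.
    by rewrite mem_primes (negPf pd) !andbF primes_uniq.
  by move=> q; rewrite primesM // primes_prime // !inE.
have logE q : q \in primes d -> logn q (p * d) = logn q d.
  rewrite mem_primes => /and3P[qp _ qd]; rewrite lognM // logn_prime //.
  by case: eqP => // qe; move: pd; rewrite -qe qd.
rewrite /mobius (perm_size pE) (perm_all _ pE) /= lognM // logn_prime // eqxx.
rewrite (@eq_in_all _ _ (fun q => logn q d == 1)%N); last first.
  by move=> q /logE ->.
have -> : logn p d = 0%N by rewrite lognE (negPf pd) !andbF.
by case: all; rewrite ?oppr0 // exprS mulN1r.
Qed.

Lemma mobius_sqr_dvd p d : prime p -> (0 < d)%N -> (p ^ 2 %| d)%N ->
  mobius d = 0.
Proof.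
move=> pp d0; rewrite pfactor_dvdn // => l2; rewrite /mobius; case: ifP => //.
move/allP => /(_ p); rewrite mem_primes pp d0 /= => /(_ _)/eqP l1.
have pd : (p %| d)%N by rewrite -[p]expn1 pfactor_dvdn // (leq_trans _ l2).
by rewrite (l1 pd) in l2.
Qed.

(** Let p be the least prime factor of n. Divisors that are multiples of p^2 contribute 0, and d ->
    p * d matches the divisors prime to p with those divisible by p exactly once, with opposite
    signs. *)
Lemma sum_mobius n : (0 < n)%N ->
  \sum_(d <- divisors n) mobius d = (n == 1)%N%:R.
Proof.
move=> n0; case: (ltngtP n 1%N) => [|n1|->]; first by case: n n0.
- have pp := pdiv_prime n1; have pn := pdiv_dvd n; set p := pdiv n in pp pn.
  have p0 := prime_gt0 pp.
  rewrite (bigID (fun d => p %| d)%N) /= (bigID (fun d => p ^ 2 %| d)%N) /=.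
  rewrite big_seq_cond big1 ?add0r; last first.
    move=> d /andP[]; rewrite -dvdn_divisors // => dn /andP[_].
    by apply: mobius_sqr_dvd => //; apply: dvdn_gt0 dn.
  have pE : perm_eq [seq d <- divisors n | (p %| d) && ~~ (p ^ 2 %| d)]%N
     [seq (p * d)%N | d <- divisors n & ~~ (p %| d)%N].
    apply: uniq_perm.
    - by rewrite filter_uniq // divisors_uniq.
    - rewrite map_inj_uniq ?filter_uniq ?divisors_uniq // => x y /eqP.
      by rewrite eqn_pmul2l // => /eqP.
    move=> d; rewrite mem_filter; apply/idP/mapP.
      rewrite -dvdn_divisors // => /andP[/andP[/dvdnP[k ->] pk]] kn; exists k.
        rewrite mem_filter -dvdn_divisors // (dvdn_trans _ kn) ?dvdn_mulr // andbT.
        by move: pk; rewrite mulnC dvdn_pmul2l.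
      by rewrite mulnC.
    move=> [k]; rewrite mem_filter -!dvdn_divisors // => /andP[pk kn] ->.
    rewrite dvdn_mulr // dvdn_pmul2l // pk /= Gauss_dvd ?pn //.
    by rewrite prime_coprime.
  rewrite -big_filter (perm_big _ pE) /= big_map big_filter /=.
  rewrite [X in _ + X]big_seq_cond [X in X + _]big_seq_cond -big_split /=.
  apply: big1 => d /andP[]; rewrite -dvdn_divisors // => dn pd.
  by rewrite mobius_primeM ?addNr // (dvdn_gt0 n0 dn).
- by rewrite big_seq1.
Qed.

Definition zrange (K : nat) : seq int :=
  0 :: [seq i%:Z | i <- iota 1 K] ++ [seq - i%:Z | i <- iota 1 K].

Lemma mem_zrange K x : (x \in zrange K) = (`|x| <= K)%N.
Proof.
rewrite inE mem_cat; apply/idP/idP.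
  case/or3P => [/eqP->|/mapP[i]|/mapP[i]] //; rewrite mem_iota => ? ->; lia.
move=> xK; case: (ltrgt0P x) => x0 //.
- apply/or3P/Or32/mapP; exists `|x|%N; rewrite ?mem_iota; lia.
- apply/or3P/Or33/mapP; exists `|x|%N; rewrite ?mem_iota; lia.
Qed.

Lemma zrange_uniq K : uniq (zrange K).
Proof.
have inj1 : injective (fun i : nat => i%:Z) by move=> i j; lia.
have inj2 : injective (fun i : nat => - i%:Z) by move=> i j; lia.
rewrite /zrange /= mem_cat negb_or cat_uniq !map_inj_uniq ?iota_uniq //= andbT.
apply/andP; split.
  by apply/andP; split; apply/negP => /mapP[i]; rewrite mem_iota; lia.
apply/hasPn => x /mapP[i]; rewrite mem_iota => i1 ->; apply/negP => /mapP[j].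
by rewrite mem_iota; lia.
Qed.

Lemma big_zrange (V : nmodType) K (F : int -> V) :
  \sum_(x <- zrange K) F x =
  F 0 + \sum_(1 <= i < K.+1) F i%:Z + \sum_(1 <= i < K.+1) F (- i%:Z).
Proof. by rewrite big_cons big_cat !big_map addrA /index_iota subSS subn0. Qed.

Lemma sum_zrangeS (V : nmodType) K (F : int -> V) :
  \sum_(x <- zrange K.+1) F x =
  \sum_(x <- zrange K) F x + (F K.+1%:Z + F (- K.+1%:Z)).
Proof. by rewrite !big_zrange !(big_nat_recr K.+1) //= !addrA; congr (_ + _); rewrite -!addrA; congr (_ + _); congr (_ + _); rewrite addrC. Qed.

Lemma sum_zrange_dvd K d : (0 < d)%N ->
  (\sum_(x <- zrange K) (d %| `|x|) = 2 * (K %/ d) + 1)%N.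
Proof.
move=> d0; rewrite (big_zrange nat) /= divn_count_dvd.
under [X in (_ + X)%R]eq_bigr do rewrite abszN.
rewrite dvdn0 -[LHS]/(1 + \sum_(1 <= i < K.+1) (d %| i) + \sum_(1 <= i < K.+1) (d %| i))%N.
by move: (\sum_(_ <= _ < _) _)%N => n; lia.
Qed.

Lemma sum_nat_pred_size {I : eqType} (s : seq I) (P : pred I) :
  (\sum_(x <- s) P x)%N = size [seq x <- s | P x].
Proof.
rewrite size_filter -sum1_count [RHS]big_mkcond /=.
by apply: eq_bigr => i _; case: (P i).
Qed.

(** The map x -> floor((x + B) / q) is injective on a residue class modulo q and takes at most 2B/q
    + 1 values on [-B, B]; then q <= B gives 2B + q <= 3B. *)
Lemma size_congr_class (s : seq int) (q B : nat) : uniq s -> (0 < q <= B)%N ->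
  {in s, forall x, `|x| <= B}%N ->
  {in s &, forall x y, (q%:Z %| x - y)%Z} -> (q * size s <= 3 * B)%N.
Proof.
move=> us /andP[q0 qB] sB sq.
pose f (x : int) := (`|(x + B%:Z)%R| %/ q)%N.
have inj : {in s &, injective f}.
  move=> x y xs ys; rewrite /f => e.
  have /dvdzP[k ke] := sq x y xs ys; have := sB x xs; have := sB y ys => hy hx.
  have := divn_eq `|(x + B%:Z)%R|%N q; have := divn_eq `|(y + B%:Z)%R|%N q.
  have := ltn_pmod `|(x + B%:Z)%R|%N q0; have := ltn_pmod `|(y + B%:Z)%R|%N q0.
  rewrite e; set u := (_ %/ _)%N; set r1 := (_ %% _)%N; set r2 := (_ %% _)%N.
  move=> r1q r2q e1 e2.
  have xyr : x - y = r2%:Z - r1%:Z.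
    move: e1 e2; move: (u * q)%N => t; lia.
  have k0 : k = 0 by nia.
  by move: ke; rewrite k0; lia.
have : {subset map f s <= iota 0 ((2 * B) %/ q).+1}.
  move=> _ /mapP[x xs ->]; rewrite mem_iota add0n ltnS /f leq_div2r //=.
  by have := sB x xs; lia.
move/(uniq_leq_size _); rewrite map_inj_in_uniq // size_iota size_map => /(_ us).
move=> h; have : (q * size s <= q * ((2 * B) %/ q).+1)%N by rewrite leq_mul2l h orbT.
have := leq_divM (2 * B) q; nia.
Qed.

(** With g = gcd(y, m), the congruence y z + c = 0 modulo m is solvable only if g | c, and its
    solutions lie in one class modulo q = m / g, to which [size_congr_class] applies. *)
Lemma sum_zrange_congr (m : nat) (y c : int) : (0 < m)%N ->
  (m * \sum_(z <- zrange m) (m%:Z %| (y * z + c)%R)%Z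
    <= (gcdn `|y| m %| `|c|) * (3 * m * gcdn `|y| m))%N.
Proof.
move=> m0; set g := gcdn _ _.
have g0 : (0 < g)%N by rewrite gcdn_gt0 m0 orbT.
have gm : (g %| m)%N by apply: dvdn_gcdr.
have gy : (g %| `|y|)%N by apply: dvdn_gcdl.
have /dvdnP[q mE] := gm; have q0 : (0 < q)%N by case: q mE m0 => [->|].
set P := fun z : int => (m%:Z %| (y * z + c)%R)%Z.
rewrite sum_nat_pred_size.
case: (boolP (g %| _)%N) => [gc|ngc]; last first.
  rewrite mul0n leqn0 muln_eq0 size_eq0; apply/orP; right; apply/eqP.
  apply/eqP; rewrite -(negbK (_ == _)) -has_filter; apply/negP => /hasP[z _ Pz].
  case/negP: ngc; rewrite -[(_ %| _)%N]/((g%:Z %| c)%Z).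
  have gyz : (g%:Z %| y * z)%Z by apply: dvdz_mulr.
  have : (g%:Z %| y * z + c)%Z by apply: dvdz_trans Pz.
  by rewrite rpredDl.
rewrite mul1n [X in (X * _)%N]mE mulnAC mulnC [X in (_ <= X)%N]mulnC leq_mul2l; apply/orP; right.
apply: size_congr_class.
- by rewrite filter_uniq // zrange_uniq.
- by rewrite q0 mE leq_pmulr.
- by move=> x; rewrite mem_filter mem_zrange => /andP[].
move=> x z; rewrite !mem_filter => /andP[Px _] /andP[Pz _].
have : (m%:Z %| y * (x - z))%Z.
  by rewrite (_ : _ * _ = (y * x + c) - (y * z + c)); [exact: rpredB | ring].
rewrite /dvdz /in_mem /= abszM => h.
have /dvdnP[y' yE] := gy.
have cop : coprime q y'.
  have : (gcdn (y' * g) (q * g) = g)%N by rewrite -yE -mE.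
  rewrite -muln_gcdl => /eqP; rewrite -[X in _ == X]mul1n eqn_pmul2r // => /eqP e.
  by rewrite /coprime gcdnC e.
move: h; rewrite yE mE mulnAC [(q * g)%N]mulnC.
rewrite [X in (_ %| X)%N]mulnC dvdn_pmul2l // Gauss_dvdr //.
Qed.

Definition ndiv (n : nat) : nat := size (divisors n).

(** Sort the y by g = gcd(y, m), a divisor of c: at most 3m/g values of y are multiples of g, and
    each has at most 3g solutions z, hence 9m per divisor. *)
Lemma sum_congr_le (m : nat) (c : int) : (0 < m)%N -> c != 0 ->
  (\sum_(y <- zrange m) \sum_(z <- zrange m) (m%:Z %| (y * z + c)%R)%Z
    <= 9 * m * ndiv `|c|)%N.
Proof.
move=> m0 c0; have c0' : (0 < `|c|)%N by rewrite absz_gt0.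
rewrite -(@leq_pmul2l m) // big_distrr /=.
(* The term of the gcd is bounded by the sum over all common divisors g of c and m that divide y, so
   that the order of summation can be exchanged. *)
apply: (@leq_trans (\sum_(y <- zrange m) \sum_(g <- divisors `|c| | g %| m)
   3 * m * (g * (g %| `|y|)))%N).
  apply: leq_sum => y _; apply: leq_trans (sum_zrange_congr m y c m0) _.
  case: (boolP (_ %| _)%N) => // gc; rewrite mul1n.
  have gm : (gcdn `|y| m %| m)%N by apply: dvdn_gcdr.
  rewrite -big_filter (bigD1_seq (gcdn `|y| m)) ?filter_uniq ?divisors_uniq //=; last first.
    by rewrite mem_filter gm -dvdn_divisors.
  by rewrite dvdn_gcdl muln1 leq_addr.
rewrite exchange_big /=.
apply: (@leq_trans (\sum_(g <- divisors `|c| | g %| m) (3 * m * (3 * m)))%N).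
  rewrite big_seq_cond [X in (_ <= X)%N]big_seq_cond.
  apply: leq_sum => g /andP[]; rewrite -dvdn_divisors // => gc gm.
  have g0 : (0 < g)%N := dvdn_gt0 c0' gc.
  rewrite -big_distrr -big_distrr /= sum_zrange_dvd // leq_mul2l; apply/orP; right.
  have := divnK gm; have : (g <= m)%N by apply: dvdn_leq.
  nia.
rewrite big_const_seq iter_addn_0 /ndiv.
have : (count (fun g => g %| m) (divisors `|c|) <= size (divisors `|c|))%N by apply: count_size.
nia.
Qed.

Lemma leq_sum_at_most_one {I : eqType} (s : seq I) (P : pred I) (b : bool) : uniq s ->
  {in s &, forall x y, P x -> P y -> x = y} -> {in s, forall x, P x -> b} ->
  (\sum_(x <- s) P x <= b)%N.
Proof.
move=> us inj Pb; case: (boolP (has P s)) => [/hasP[x xs Px]|/hasPn nP]; last first.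
  by rewrite big_seq big1 // => x /nP/negPf->.
rewrite (Pb x xs Px) (bigD1_seq x) //= Px big_seq_cond big1 // => y /andP[ys yx].
by case: (boolP (P y)) => // Py; rewrite (inj y x) // eqxx in yx.
Qed.

(** * Dependence of the number of solutions on the radius of the box *)

Definition ndet (h N : nat) : nat :=
  (\sum_(x1 <- zrange N) \sum_(x2 <- zrange N) \sum_(x3 <- zrange N)
    \sum_(x4 <- zrange N) (x1 * x4 - x2 * x3 == h%:Z)%R)%N.

(** A new solution has a coordinate e = +-(m+1). The remaining ones satisfy y z + c = e w with c =
    +-h, so (y, z) solves a congruence modulo m+1 and determines w. Four positions, two signs and
    the bound 9 (m+1) [ndiv h] give the constant 72. *)
Lemma ndetS_le h m : (0 < h)%N ->
  (ndet h m.+1 <= ndet h m + 72 * m.+1 * ndiv h)%N.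
Proof.
move=> h0; pose E : seq int := [:: m.+1%:Z; - m.+1%:Z].
have sE (G : int -> nat) : (\sum_(x <- E) G x = G m.+1%:Z + G (- m.+1%:Z))%N.
  by rewrite /E !big_cons big_nil addn0.
have split (G : int -> nat) : (\sum_(x <- zrange m.+1) G x =
    \sum_(x <- zrange m) G x + \sum_(x <- E) G x)%N.
  by rewrite [LHS](sum_zrangeS nat) sE.
have mono (G : int -> nat) : (\sum_(x <- zrange m) G x <= \sum_(x <- zrange m.+1) G x)%N.
  by rewrite split leq_addr.
set U := (9 * m.+1 * ndiv h)%N.
have key (c e : int) (D : int -> int -> int -> bool) : (`|c| = h)%N -> e \in E ->
    (forall y z w, D y z w -> y * z + c = e * w) ->
    (\sum_(y <- zrange m.+1) \sum_(z <- zrange m.+1) \sum_(w <- zrange m.+1) D y z w <= U)%N.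
  move=> ch eE DE.
  have e0 : e != 0 by move: eE; rewrite !inE => /orP[] /eqP->; lia.
  have em : (`|e| = m.+1)%N by move: eE; rewrite !inE => /orP[] /eqP->; lia.
  rewrite /U -ch; apply: leq_trans (sum_congr_le m.+1 c _ _) => //; last by lia.
  apply: leq_sum => y _; apply: leq_sum => z _.
  apply: leq_sum_at_most_one; first exact: zrange_uniq.
    by move=> w w' _ _ /DE h1 /DE; rewrite h1 => /(mulfI e0).
  move=> w _ /DE ->; rewrite /dvdz /in_mem /= abszM em; exact: dvdn_mulr.
have sumE (G : int -> nat) : (forall e, e \in E -> G e <= U)%N -> (\sum_(e <- E) G e <= 2 * U)%N.
  move=> GU; rewrite sE mul2n -addnn.
  by apply: leq_add; apply: GU; rewrite !inE eqxx ?orbT.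
have b1 : (\sum_(x1 <- E) \sum_(x2 <- zrange m.+1) \sum_(x3 <- zrange m.+1)
    \sum_(x4 <- zrange m.+1) (x1 * x4 - x2 * x3 == h%:Z)%R <= 2 * U)%N.
  apply: sumE => e eE.
  by apply: (key h e _ _ eE (fun x2 x3 x4 => _)) => // y z w /eqP; lia.
have b2 : (\sum_(x2 <- E) \sum_(x1 <- zrange m.+1) \sum_(x4 <- zrange m.+1)
    \sum_(x3 <- zrange m.+1) (x1 * x4 - x2 * x3 == h%:Z)%R <= 2 * U)%N.
  apply: sumE => e eE.
  by apply: (key (- h%:Z) e _ _ eE (fun x1 x4 x3 => _)) => [|y z w /eqP]; lia.
have b3 : (\sum_(x3 <- E) \sum_(x1 <- zrange m.+1) \sum_(x4 <- zrange m.+1)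
    \sum_(x2 <- zrange m.+1) (x1 * x4 - x2 * x3 == h%:Z)%R <= 2 * U)%N.
  apply: sumE => e eE.
  by apply: (key (- h%:Z) e _ _ eE (fun x1 x4 x3 => _)) => [|y z w /eqP]; lia.
have b4 : (\sum_(x4 <- E) \sum_(x2 <- zrange m.+1) \sum_(x3 <- zrange m.+1)
    \sum_(x1 <- zrange m.+1) (x1 * x4 - x2 * x3 == h%:Z)%R <= 2 * U)%N.
  apply: sumE => e eE.
  by apply: (key h e _ _ eE (fun x2 x3 x4 => _)) => // y z w /eqP; lia.
pose F x1 x2 x3 x4 : nat := (x1 * x4 - x2 * x3 == h%:Z).
have ex (A B C : seq int) (G : int -> int -> int -> nat) :
   (\sum_(x <- A) \sum_(y <- B) \sum_(z <- C) G x y z =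
    \sum_(z <- C) \sum_(x <- A) \sum_(y <- B) G x y z)%N.
  by rewrite [RHS]exchange_big /=; apply: eq_bigr => x _; rewrite exchange_big.
(* The ranges are enlarged one coordinate at a time, from x4 to x1. Each enlargement adds a slice
   with one extremal coordinate, bounded by [b4], [b3], [b2], [b1] after the other ranges are
   extended to m+1. *)
have c4 : (\sum_(x1 <- zrange m) \sum_(x2 <- zrange m) \sum_(x3 <- zrange m)
   \sum_(x4 <- zrange m.+1) F x1 x2 x3 x4 <= ndet h m + 2 * U)%N.
  under eq_bigr do under eq_bigr do under eq_bigr do rewrite split.
  under eq_bigr do under eq_bigr do rewrite big_split.
  under eq_bigr do rewrite big_split.
  rewrite big_split /= leq_add2l; apply: leq_trans b4.
  under eq_bigr do rewrite ex.
  rewrite exchange_big; apply: leq_sum => x4 _ /=.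
  rewrite ex ex.
  apply: leq_trans (mono _) _; apply: leq_sum => x2 _.
  apply: leq_trans (mono _) _; apply: leq_sum => x3 _.
  exact: mono.
have c3 : (\sum_(x1 <- zrange m) \sum_(x2 <- zrange m) \sum_(x3 <- zrange m.+1)
   \sum_(x4 <- zrange m.+1) F x1 x2 x3 x4 <= ndet h m + 4 * U)%N.
  under eq_bigr do under eq_bigr do rewrite split.
  under eq_bigr do rewrite big_split.
  rewrite big_split /=.
  suff : (\sum_(x1 <- zrange m) \sum_(x2 <- zrange m) \sum_(x3 <- E)
   \sum_(x4 <- zrange m.+1) F x1 x2 x3 x4 <= 2 * U)%N by lia.
  apply: leq_trans b3; rewrite ex; apply: leq_sum => x3 _.
  apply: leq_trans (mono _) _; apply: leq_sum => x1 _.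
  apply: leq_trans (mono _) _; rewrite exchange_big; exact: leqnn.
have c2 : (\sum_(x1 <- zrange m) \sum_(x2 <- zrange m.+1) \sum_(x3 <- zrange m.+1)
   \sum_(x4 <- zrange m.+1) F x1 x2 x3 x4 <= ndet h m + 6 * U)%N.
  under eq_bigr do rewrite split.
  rewrite big_split /= (_ : 6 * U = 4 * U + 2 * U)%N; last by lia.
  rewrite addnA; apply: leq_add c3 _.
  apply: leq_trans b2; rewrite exchange_big; apply: leq_sum => x2 _.
  apply: leq_trans (mono _) _; apply: leq_sum => x1 _; rewrite exchange_big; exact: leqnn.
rewrite {1}/ndet split; apply: leq_trans (leq_add c2 b1) _.
by rewrite /U; lia.
Qed.

Lemma ndet_le h m n : (0 < h)%N -> (m <= n)%N ->
  (ndet h m <= ndet h n <= ndet h m + 72 * n * (n - m) * ndiv h)%N.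
Proof.
move=> h0 /subnK <-; move: (n - m)%N => k {n}; rewrite addnK addnC.
elim: k => [|k /andP[IH1 IH2]]; first by rewrite addn0 muln0 mul0n addn0 leqnn.
rewrite addnS; apply/andP; split.
  have mono (G : int -> nat) : (\sum_(x <- zrange (m + k)) G x <= \sum_(x <- zrange (m + k).+1) G x)%N.
    by rewrite [X in (_ <= X)%N](sum_zrangeS nat) leq_addr.
  rewrite (leq_trans IH1) // /ndet.
  apply: leq_trans (mono _) _; apply: leq_sum => x1 _.
  apply: leq_trans (mono _) _; apply: leq_sum => x2 _.
  apply: leq_trans (mono _) _; apply: leq_sum => x3 _.
  exact: mono.
apply: leq_trans (ndetS_le h (m + k) h0) _.
by move: IH2; nia.
Qed.

(** * Submultiplicativity of the divisor function *)

Lemma ndivM_le m n : (0 < m)%N -> (0 < n)%N -> (ndiv (m * n) <= ndiv m * ndiv n)%N.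
Proof.
move=> m0 n0; have mn0 : (0 < m * n)%N by rewrite muln_gt0 m0.
rewrite /ndiv -(size_allpairs pair).
(* The product of the two components recovers d. The second one is coprime to m / gcd(d, m) and
   divides its product with n, hence divides n. *)
pose f d := (gcdn d m, d %/ gcdn d m)%N.
rewrite -(size_map f); apply: uniq_leq_size.
  rewrite map_inj_in_uniq ?divisors_uniq // => x y _ _ [e1].
  rewrite e1 => /eqP; rewrite -(@eqn_pmul2r (gcdn y m)) ?gcdn_gt0 ?m0 ?orbT //.
  by rewrite (divnK (dvdn_gcdl y m)) -e1 (divnK (dvdn_gcdl x m)) => /eqP.
move=> _ /mapP[d dmn ->]; rewrite -dvdn_divisors // in dmn.
apply: allpairs_f; rewrite -dvdn_divisors ?dvdn_gcdr //.
have g0 : (0 < gcdn d m)%N by rewrite gcdn_gt0 m0 orbT.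
have dE := divnK (dvdn_gcdl d m); have mE := divnK (dvdn_gcdr d m).
set d' := (d %/ _)%N in dE *; set m' := (m %/ _)%N in mE.
have cop : coprime d' m'.
  have : (gcdn (d' * gcdn d m) (m' * gcdn d m) = 1 * gcdn d m)%N by rewrite dE mE mul1n.
  by rewrite -muln_gcdl => /eqP; rewrite eqn_pmul2r.
rewrite -(Gauss_dvdr _ cop) -(@dvdn_pmul2r (gcdn d m)) // dE mulnAC mE //.
Qed.

Lemma ndiv_primeX p e : prime p -> ndiv (p ^ e) = e.+1.
Proof.
move=> pp; have p1 := prime_gt1 pp; have p0 := prime_gt0 pp.
rewrite /ndiv (perm_size (_ : perm_eq _ [seq p ^ i | i <- iota 0 e.+1]%N)) ?size_map ?size_iota //.
apply: uniq_perm; rewrite ?divisors_uniq //.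
  by rewrite map_inj_uniq ?iota_uniq // => i j /eqP; rewrite eqn_exp2l // => /eqP.
move=> d; rewrite -dvdn_divisors ?expn_gt0 ?p0 //.
apply/(dvdn_pfactor _ _ pp)/mapP => -[i].
  by move=> ie ->; exists i => //; rewrite mem_iota ltnS.
by rewrite mem_iota ltnS => ie ->; exists i.
Qed.

(** * Sublattices of index h in Hermite normal form *)

Definition det2 (v w : int * int) : int := v.1 * w.2 - v.2 * w.1.

Definition box (K : nat) : seq (int * int) := [seq (x, y) | x <- zrange K, y <- zrange K].

Lemma mem_box K v : (v \in box K) = ((`|v.1| <= K) && (`|v.2| <= K))%N.
Proof.
rewrite -!mem_zrange; case: v => x y /=; apply/allpairsP/andP => [[[x' y'] /= [? ? [-> ->]]] //|[xK yK]].
by exists (x, y).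
Qed.

Lemma box_uniq K : uniq (box K).
Proof. by apply: allpairs_uniq; rewrite ?zrange_uniq // => -[? ?] [? ?]. Qed.

(** Every sublattice of index h has exactly one basis (a, 0), (j, h / a) with a | h and 0 <= j < a,
    so these pairs index the sublattices without repetition. *)
Definition lattices (h : nat) : seq (nat * nat) :=
  [seq (a, j) | a <- divisors h, j <- iota 0 a].

Lemma mem_lattices h l : (0 < h)%N -> (l \in lattices h) = (l.1 %| h)%N && (l.2 < l.1)%N.
Proof.
move=> h0; rewrite dvdn_divisors //.
apply/allpairsPdep/andP => [[a [j [ah ja ->]]]|[lh l2]].
  by rewrite mem_iota in ja.
by exists l.1, l.2; rewrite mem_iota; case: l lh l2.
Qed.

Lemma lattices_uniq h : uniq (lattices h).
Proof.
apply: allpairs_uniq_dep; rewrite ?divisors_uniq //.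
  by move=> a _; exact: iota_uniq.
by move=> [a j] [a' j'] _ _ [-> ->].
Qed.

Lemma size_lattices h : size (lattices h) = \sum_(d <- divisors h) d.
Proof.
rewrite /lattices size_allpairs_dep sumnE big_map.
by apply: eq_bigr => a _; rewrite size_iota.
Qed.

(* The pair l = (a, j) stands for the lattice spanned by (a, 0) and (j, h / a). *)
Definition in_lat (h : nat) (l : nat * nat) (v : int * int) : bool :=
  ((h %/ l.1)%N %| v.2)%Z && (l.1 %| (v.1 - (v.2 %/ (h %/ l.1)%N)%Z * l.2%:Z)%R)%Z.

Lemma in_latP h l v : (0 < h)%N -> l \in lattices h ->
  reflect (exists s t : int, v.1 = s * l.1%:Z + t * l.2%:Z /\ v.2 = t * (h %/ l.1)%N%:Z)
    (in_lat h l v).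
Proof.
move=> h0; rewrite mem_lattices // => /andP[lh _].
have l0 : (0 < l.1)%N := dvdn_gt0 h0 lh.
have d0 : (h %/ l.1)%N%:Z != 0.
  rewrite eqz_nat -lt0n divn_gt0 //; exact: dvdn_leq.
apply: (iffP andP) => [[/dvdzP[t t2] /dvdzP[s]]|[s [t [e1 e2]]]].
  by rewrite t2 mulzK // => e; exists s, t; split=> //; rewrite -e; ring.
rewrite e2 mulzK // dvdz_mull //; split => //.
by apply/dvdzP; exists s; rewrite e1; ring.
Qed.

Lemma in_lat_comb h l v w (a b : int) : (0 < h)%N -> l \in lattices h ->
  in_lat h l v -> in_lat h l w ->
  in_lat h l (a * v.1 + b * w.1, a * v.2 + b * w.2).
Proof.
move=> h0 lh /in_latP-/(_ h0 lh)[s [t [e1 e2]]] /in_latP-/(_ h0 lh)[s' [t' [e1' e2']]].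
apply/in_latP => //; exists (a * s + b * s'), (a * t + b * t') => /=.
by rewrite e1 e2 e1' e2'; split; ring.
Qed.

(** The factor k is the determinant of the coordinates of v and w in the basis of the sublattice,
    which itself has determinant h. *)
Lemma in_lat_dvd h l v w : (0 < h)%N -> l \in lattices h ->
  in_lat h l v -> in_lat h l w -> exists k : int, det2 v w = k * h%:Z.
Proof.
move=> h0 lh /in_latP-/(_ h0 lh)[s [t [e1 e2]]] /in_latP-/(_ h0 lh)[s' [t' [e1' e2']]].
exists (s * t' - t * s'); rewrite /det2 e1 e2 e1' e2'.
have hE : h%:Z = (h %/ l.1)%N%:Z * l.1%:Z.
  by move: lh; rewrite mem_lattices // => /andP[lh _]; rewrite -PoszM divnK.
rewrite hE; ring.
Qed.

(** Reduction to Hermite form: let d be the gcd of the second coordinates, d * t and d * t'. Then t'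
    v - t w = (a, 0) with a = h / d, and a Bezout combination of v and w has second coordinate d;
    its first coordinate reduced modulo a is j. *)
Lemma in_lat_exists h v w : (0 < h)%N -> det2 v w = h%:Z ->
  exists2 l, l \in lattices h & in_lat h l v && in_lat h l w.
Proof.
case: v w => x y [z u] h0; rewrite /det2 /= => dE.
set d := gcdn `|y| `|u|.
have dy : (d%:Z %| y)%Z by rewrite /dvdz /in_mem /= dvdn_gcdl.
have du : (d%:Z %| u)%Z by rewrite /dvdz /in_mem /= dvdn_gcdr.
have dh : (d %| h)%N.
  by rewrite -[(_ %| _)%N]/((d%:Z %| h%:Z)%Z) -dE; apply: rpredB; [exact: dvdz_mull | exact: dvdz_mulr].
have d0 : (0 < d)%N by apply: dvdn_gt0 dh.
have /dvdzP[t yE] := dy; have /dvdzP[t' uE] := du.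
have [al [be]] : exists al be : int, al * t + be * t' = 1.
  have [al [be e]] := Bezoutz y u; exists al, be.
  apply: (@mulIf _ d%:Z); first by rewrite eqz_nat -lt0n.
  by rewrite mul1r mulrDl -!mulrA -yE -uE e.
move=> bez; have /dvdnP[a hE] := dh.
have a0 : (0 < a)%N by case: a hE h0 => // ->.
have tE : x * t' - t * z = a%:Z.
  apply: (@mulIf _ d%:Z); first by rewrite eqz_nat -lt0n.
  by rewrite -PoszM -hE -dE yE uE; ring.
pose j := ((al * x + be * z) %% a%:Z)%Z.
have jE := divz_eq (al * x + be * z) a%:Z; set k := (_ %/ _)%Z in jE.
have j0 : 0 <= j by rewrite modz_ge0 // eqz_nat -lt0n.
have ja : j < a%:Z by rewrite ltz_pmod.
have jj : `|j|%N%:Z = j by rewrite gez0_abs.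
have lh : (a, `|j|%N) \in lattices h.
  by rewrite mem_lattices //= hE dvdn_mulr //=; lia.
have had : (h %/ a = d)%N by rewrite hE mulKn.
exists (a, `|j|%N) => //; apply/andP; split; apply/in_latP => //=; rewrite had jj.
- exists (t * k + be), t; split => //.
  have -> : j = al * x + be * z - k * a%:Z by rewrite jE /j; ring.
  rewrite -tE -[LHS]mulr1 -[X in _ * X = _]bez; ring.
exists (t' * k - al), t'; split => //.
have -> : j = al * x + be * z - k * a%:Z by rewrite jE /j; ring.
rewrite -tE -[LHS]mulr1 -[X in _ * X = _]bez; ring.
Qed.

(** The coordinates of v, w have determinant 1 in either sublattice, so v, w is a basis of both, and
    the normal form can be read off from v and w. *)
Lemma in_lat_inj h v w l l' : (0 < h)%N -> det2 v w = h%:Z ->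
  l \in lattices h -> l' \in lattices h ->
  in_lat h l v && in_lat h l w -> in_lat h l' v && in_lat h l' w -> l = l'.
Proof.
case: l l' => a j [a' j'] h0 dE lh lh'.
move=> /andP[/in_latP-/(_ h0 lh)[s [t [e1 e2]]] /in_latP-/(_ h0 lh)[s1 [t1 [f1 f2]]]].
move=> /andP[/in_latP-/(_ h0 lh')[s' [t' [e1' e2']]] /in_latP-/(_ h0 lh')[s1' [t1' [f1' f2']]]].
move: lh lh'; rewrite !mem_lattices //= => /andP[ah ja] /andP[ah' ja'].
move: e1 e2 f1 f2 e1' e2' f1' f2' => /=.
have := divnK ah; have := divnK ah'; set d := (h %/ a)%N; set d' := (h %/ a')%N.
move=> hE' hE e1 e2 f1 f2 e1' e2' f1' f2'.
have hZ : h%:Z = d%:Z * a%:Z by rewrite -hE PoszM.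
have hZ' : h%:Z = d'%:Z * a'%:Z by rewrite -hE' PoszM.
have d0 : (0 < d)%N by case: (d) hE h0 => // <-.
have d0' : (0 < d')%N by case: (d') hE' h0 => // <-.
have h0' : h%:Z != 0 by rewrite eqz_nat -lt0n.
have D : s * t1 - t * s1 = 1.
  apply: (mulIf h0'); rewrite mul1r -{2}dE /det2 e1 e2 f1 f2 hZ; ring.
have D' : s' * t1' - t' * s1' = 1.
  apply: (mulIf h0'); rewrite mul1r -{2}dE /det2 e1' e2' f1' f2' hZ'; ring.
(* Both d and d' are integral combinations of the second coordinates of v and w, so each divides the
   other. *)
have dd : (d %| d')%N.
  rewrite -[(_ %| _)%N]/((d%:Z %| d'%:Z)%Z); apply/dvdzP; exists (s' * t1 - t * s1').
  have : (s' * t1' - t' * s1') * d'%:Z = d'%:Z by rewrite D' mul1r.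
  rewrite mulrBl -!mulrA -f2' -(mulrCA s1') -e2' e2 f2 => <-; ring.
have dd' : (d' %| d)%N.
  rewrite -[(_ %| _)%N]/((d'%:Z %| d%:Z)%Z); apply/dvdzP; exists (s * t1' - t' * s1).
  have : (s * t1 - t * s1) * d%:Z = d%:Z by rewrite D mul1r.
  rewrite mulrBl -!mulrA -f2 -(mulrCA s1) -e2 e2' f2' => <-; ring.
have {dd dd'} de : d = d' by apply/eqP; rewrite eqn_dvd dd dd'.
have ae : a = a' by apply/eqP; rewrite -(eqn_pmul2l d0) hE de hE'.
have dz : d%:Z != 0 by rewrite eqz_nat -lt0n.
have tt : t = t' by apply: (mulIf dz); rewrite -e2 {1}de e2'.
have tt1 : t1 = t1' by apply: (mulIf dz); rewrite -f2 {1}de f2'.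
(* Multiples of j - j' by t and by t1 are divisible by a, and s t1 - t s1 = 1 combines them; since 0
   <= j, j' < a this forces j = j'. *)
have aj : j%:Z - j'%:Z = (s * (s1' - s1) - s1 * (s' - s)) * a%:Z.
  have E1 : t * (j%:Z - j'%:Z) = (s' - s) * a%:Z.
    by have := e1'; rewrite e1 -tt -ae => E; lia.
  have E2 : t1 * (j%:Z - j'%:Z) = (s1' - s1) * a%:Z.
    by have := f1'; rewrite f1 -tt1 -ae => E; lia.
  rewrite -[LHS]mul1r -D.
  transitivity (s * (t1 * (j%:Z - j'%:Z)) - s1 * (t * (j%:Z - j'%:Z))); first ring.
  rewrite E1 E2; ring.
rewrite -ae in ja' *.
congr (_, _); move: aj; set k := (_ - _ * _) => aj.
by have : k = 0 by [nia]; move=> k0; rewrite k0 in aj; lia.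
Qed.

Lemma sum_unique {I : eqType} (s : seq I) (P : pred I) : uniq s ->
  (exists2 x, x \in s & P x) -> {in s &, forall x y, P x -> P y -> x = y} ->
  (\sum_(x <- s) P x = 1)%N.
Proof.
move=> us [x xs Px] inj; apply/eqP; rewrite eqn_leq.
rewrite (leq_sum_at_most_one s P true) //=.
by rewrite (bigD1_seq x) //= Px.
Qed.

Lemma sum_lattices_pair h v w : (0 < h)%N -> det2 v w = h%:Z ->
  (\sum_(l <- lattices h) (in_lat h l v && in_lat h l w) = 1)%N.
Proof.
move=> h0 dE; apply: sum_unique; first exact: lattices_uniq.
  by have [l lh lvw] := in_lat_exists h v w h0 dE; exists l.
by move=> l l' lh lh'; apply: in_lat_inj dE lh lh'.
Qed.

(** * Primitive vectors of a sublattice, those that extend to a basis of it *)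

Definition prim_in (h : nat) (l : nat * nat) (v : int * int) : bool :=
  in_lat h l v && `[< exists2 w, in_lat h l w & det2 v w = h%:Z >].

Lemma prim_inP h l v :
  reflect (in_lat h l v /\ exists2 w, in_lat h l w & det2 v w = h%:Z) (prim_in h l v).
Proof. by apply: (iffP andP) => -[? /asboolP]. Qed.

Definition gcdv (v : int * int) : nat := gcdn `|v.1| `|v.2|.

Lemma gcdv_split v : exists u : int * int,
  [/\ v.1 = (gcdv v)%:Z * u.1, v.2 = (gcdv v)%:Z * u.2 &
      exists w, det2 u w = 1].
Proof.
have [g0|g0] := posnP (gcdv v).
  have /andP[/eqP v1 /eqP v2] : (v.1 == 0) && (v.2 == 0).
    by move/eqP: g0; rewrite -leqn0 leqNgt gcdn_gt0 negb_or -!leqNgt !leqn0 !absz_eq0.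
  (* For v = 0 the gcd is 0, so any unimodular vector can serve as u. *)
  exists (1, 0); rewrite v1 v2 g0 !mul0r; split=> //.
  by exists (0, 1); rewrite /det2 /=; ring.
have /dvdzP[a aE] : ((gcdv v)%:Z %| v.1)%Z by rewrite /dvdz /in_mem /= dvdn_gcdl.
have /dvdzP[b bE] : ((gcdv v)%:Z %| v.2)%Z by rewrite /dvdz /in_mem /= dvdn_gcdr.
exists (a, b); split; rewrite /= 1?mulrC //.
have [x [y e]] := Bezoutz v.1 v.2; exists (- y, x); rewrite /det2 /=.
apply: (@mulIf _ (gcdv v)%:Z); first by rewrite eqz_nat -lt0n.
rewrite mul1r -[X in _ = X]/(gcdz v.1 v.2) -e aE bE; ring.
Qed.

(** Write v = g u. A partner w with det(v, w) = h forces g | h. If h = c g and det(u, w') = 1, the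
    partners are c w' + k u with k an integer, and adding multiples of v = g u makes only k modulo g
    matter. Each residue gives one sublattice, hence g of them. *)
Lemma sum_prim_in h v : (0 < h)%N -> v != (0, 0) ->
  (\sum_(l <- lattices h) prim_in h l v = (gcdv v %| h) * gcdv v)%N.
Proof.
move=> h0 v0; set g := gcdv v.
have g0 : (0 < g)%N.
  rewrite gcdn_gt0 !absz_gt0; case: v v0 {g} => x y; rewrite xpair_eqE negb_and.
  by case/orP => ->; rewrite ?orbT.
have [u [e1 e2 [w' uw]]] := gcdv_split v; rewrite -/g in e1 e2.
have hz : h%:Z != 0 by rewrite eqz_nat -lt0n.
case: (boolP (g %| h)%N) => [/dvdnP[c hE]|ngh]; last first.
  rewrite mul0n; apply: big1 => l _; apply/eqP; rewrite eqb0; apply/negP.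
  move=> /prim_inP[_ [w _ dE]]; case/negP: ngh.
  rewrite -[(_ %| _)%N]/((g%:Z %| h%:Z)%Z); apply/dvdzP.
  by exists (det2 u w); rewrite -dE /det2 e1 e2; ring.
have hz' : h%:Z = c%:Z * g%:Z by rewrite hE.
rewrite mul1n; pose wk (k : nat) : int * int := (c%:Z * w'.1 + k%:Z * u.1, c%:Z * w'.2 + k%:Z * u.2).
have wkE k : det2 v (wk k) = h%:Z.
  by rewrite -[RHS]mulr1 -[X in _ = _ * X]uw hz' /det2 e1 e2 /=; ring.
(* Double counting of pairs (l, k): each k < g belongs to exactly one l, and each l in which v is
   primitive contains exactly one of the vectors [wk k]. *)
transitivity (\sum_(l <- lattices h) \sum_(k <- iota 0 g) (in_lat h l v && in_lat h l (wk k)))%N; last first.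
  rewrite exchange_big /=.
  under eq_bigr do rewrite (sum_lattices_pair h _ _ h0 (wkE _)).
  by rewrite big_const_seq iter_addn_0 count_predT size_iota mul1n.
rewrite big_seq [RHS]big_seq; apply: eq_bigr => l lh.
case: (boolP (prim_in h l v)) => [/prim_inP[vl [w wl wE]]|npr]; last first.
  rewrite big1 // => k _; apply/eqP; rewrite eqb0; apply: contra npr => /andP[vl wl].
  by apply/prim_inP; split => //; exists (wk k).
symmetry; apply: sum_unique; first exact: iota_uniq.
  have wdiff : exists m : int, w.1 - c%:Z * w'.1 = m * u.1 /\ w.2 - c%:Z * w'.2 = m * u.2.
    have cE : det2 u w = c%:Z.
      apply: (@mulIf _ g%:Z); first by rewrite eqz_nat -lt0n.
      by rewrite -hz' -wE /det2 e1 e2; ring.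
    exists (w.1 * w'.2 - w.2 * w'.1); rewrite -cE.
    rewrite -[X in X - _ = _ /\ _]mulr1 -[X in _ /\ X - _ = _]mulr1 -[X in _ * X - _ = _ /\ _]uw.
    rewrite -[X in _ /\ _ * X - _ = _]uw /det2; split; ring.
  have [m [m1 m2]] := wdiff.
  have mE := divz_eq m g%:Z; set q := (_ %/ _)%Z in mE; set r := (_ %% _)%Z in mE.
  have r0 : 0 <= r by rewrite modz_ge0 // eqz_nat -lt0n.
  have rg : r < g%:Z by rewrite ltz_pmod.
  have rr : `|r|%N%:Z = r by rewrite gez0_abs.
  exists `|r|%N; first by rewrite mem_iota; lia.
  rewrite vl /= (_ : wk _ = (1 * w.1 + (- q) * v.1, 1 * w.2 + (- q) * v.2)).
    exact: in_lat_comb.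
  rewrite /wk rr; have -> : r = m - q * g%:Z by rewrite mE; ring.
  congr (_, _).
    by rewrite mulrBl -m1 e1; ring.
  by rewrite mulrBl -m2 e2; ring.
move=> i j; rewrite !mem_iota => /andP[_ ig] /andP[_ jg] /andP[_ wi] /andP[_ wj].
have wij := in_lat_comb h l _ _ 1 (-1) h0 lh wi wj.
(* The difference of the two partners is (i - j) u; its determinant with [wk j] is (i - j) c, a
   multiple of h = c g, so g divides i - j. *)
have [k kE] := in_lat_dvd h l _ _ h0 lh wij wj.
have : (i%:Z - j%:Z) * c%:Z = k * g%:Z * c%:Z.
  rewrite -mulrA -[g%:Z * _]mulrC -hz' -kE -[X in X * _ = _]mulr1 -[X in _ * X * _ = _]uw /det2 /=; ring.
have c0 : c%:Z != 0 by apply: contra_neq hz => c0; rewrite hz' c0 mul0r.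
move/(mulIf c0) => ij; have : k = 0 by nia.
by move=> k0; rewrite k0 in ij; lia.
Qed.

(** * Primitive vectors in a box of radius less than sqrt(h) *)

Lemma hexagon_area (M a b c d : int) : `|a| <= M -> `|b| <= M -> `|c| <= M -> `|d| <= M ->
  `|a + c| <= M -> `|b + d| <= M -> a * d - b * c <= M * M.
Proof.
move=> a1 b1 c1 d1 ac bd.
(* If a and c have the same sign, then |a| + |c| = |a + c| <= M bounds the determinant by M^2, and
   similarly for b and d. Otherwise ad and bc have the same sign, so their difference is at most
   M^2. *)
case: (lerP 0 a) => a0; case: (lerP 0 b) => b0; case: (lerP 0 c) => c0; case: (lerP 0 d) => d0; nia.
Qed.

Definition negv (v : int * int) : int * int := (- v.1, - v.2).

Lemma in_lat_neg h l v : (0 < h)%N -> l \in lattices h -> in_lat h l v -> in_lat h l (negv v).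
Proof.
move=> h0 lh vl; rewrite (_ : negv v = ((-1) * v.1 + 0 * v.1, (-1) * v.2 + 0 * v.2)).
  exact: in_lat_comb.
by rewrite /negv; congr (_, _); ring.
Qed.

Lemma prim_in_neg h l v : (0 < h)%N -> l \in lattices h -> prim_in h l v -> prim_in h l (negv v).
Proof.
move=> h0 lh /prim_inP[vl [w wl wE]]; apply/prim_inP; split; first exact: in_lat_neg.
by exists (negv w); rewrite ?in_lat_neg // -wE /det2 /negv /=; ring.
Qed.

Lemma prim_in_neq0 h l v : (0 < h)%N -> prim_in h l v -> v != (0, 0).
Proof.
by move=> h0 /prim_inP[_ [w _ wE]]; apply/eqP => v0; move: wE h0; rewrite v0 /det2 /=; lia.
Qed.

Lemma negv_neq v : v != (0, 0) -> negv v != v.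
Proof.
case: v => x y; rewrite /negv !xpair_eqE /= !negb_and => /orP[] ?; apply/orP; [left|right]; lia.
Qed.

Lemma box_neg K v : (negv v \in box K) = (v \in box K).
Proof. by rewrite !mem_box /negv /= !abszN. Qed.

Lemma prim_in_pair h l v w : (0 < h)%N -> l \in lattices h ->
  in_lat h l v -> in_lat h l w -> det2 v w = h%:Z -> prim_in h l v && prim_in h l w.
Proof.
move=> h0 lh vl wl dE; apply/andP; split; apply/prim_inP; split=> //; first by exists w.
by exists (negv v); rewrite ?in_lat_neg // -dE /det2 /negv /=; ring.
Qed.

(** If v' is a partner of v, collinearity gives w = k v with k = det(w, v') / h, an integer. A
    partner w' of w yields an integer k' with k k' = 1. *)
Lemma prim_in_collinear h l v w : (0 < h)%N -> l \in lattices h ->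
  prim_in h l v -> prim_in h l w -> det2 v w = 0 -> w = v \/ w = negv v.
Proof.
move=> h0 lh /prim_inP[vl [v' vl' vE]] /prim_inP[wl [w' wl' wE]] d0.
have hz : h%:Z != 0 by rewrite eqz_nat -lt0n.
have [k kE] := in_lat_dvd h l w v' h0 lh wl vl'.
have [k' kE'] := in_lat_dvd h l v w' h0 lh vl wl'.
have w1 : w.1 = k * v.1.
  apply: (mulIf hz); rewrite mulrAC -kE -vE.
  apply/eqP; rewrite -subr_eq0 -[X in _ == X](mul0r v'.1) -d0 /det2; apply/eqP; ring.
have w2 : w.2 = k * v.2.
  apply: (mulIf hz); rewrite mulrAC -kE -vE.
  apply/eqP; rewrite -subr_eq0 -[X in _ == X](mul0r v'.2) -d0 /det2; apply/eqP; ring.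
have kk : k * k' = 1.
  apply: (mulIf hz); rewrite mul1r -mulrA -kE' -wE /det2 w1 w2; ring.
have /eqP : (`|k| * `|k'| = 1)%N by rewrite -abszM kk.
rewrite muln_eq1 => /andP[/eqP k1 _]; have [e|e] : k = 1 \/ k = -1 by lia.
  all: rewrite e in w1 w2.
- by left; case: (v) (w) w1 w2 => x y [x' y'] /= -> ->; congr (_, _); ring.
- by right; case: (v) (w) w1 w2 => x y [x' y'] /= -> ->; rewrite /negv; congr (_, _); ring.
Qed.

Lemma det2_box_le M v w : v \in box M -> w \in box M -> `|det2 v w| <= 2 * M%:Z * M%:Z.
Proof.
have lez (x : int) : (`|x| <= M)%N -> `|x| <= M%:Z by lia.
rewrite !mem_box /det2 => /andP[/lez v1 /lez v2] /andP[/lez w1 /lez w2].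
apply: le_trans (ler_normB _ _) _; rewrite !normrM (_ : 2 * M%:Z * M%:Z = M%:Z * M%:Z + M%:Z * M%:Z); last ring.
by apply: lerD; apply: ler_pM.
Qed.

(** The determinant is a multiple of h of absolute value at most 2 M^2 < 2 h. *)
Lemma det2_in_box h l M v w : (M * M < h)%N -> l \in lattices h ->
  v \in box M -> w \in box M -> in_lat h l v -> in_lat h l w ->
  [\/ det2 v w = 0, det2 v w = h%:Z | det2 v w = - h%:Z].
Proof.
move=> Mh lh vM wM vl wl; have h0 : (0 < h)%N by lia.
have [k kE] := in_lat_dvd h l v w h0 lh vl wl.
have := det2_box_le M v w vM wM; rewrite kE => kM.
have [->|[->|->]] : k = 0 \/ k = 1 \/ k = -1.
  move: kM; rewrite normrM; nia.
- by constructor 1; rewrite mul0r.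
- by constructor 2; rewrite mul1r.
by constructor 3; rewrite mulN1r.
Qed.

Lemma sum_not_in_box h M v w : (M * M < h)%N -> v \in box M -> w \in box M ->
  `|det2 v w| = h%:Z -> (v.1 + w.1, v.2 + w.2) \notin box M.
Proof.
rewrite !mem_box /= => Mh /andP[v1 v2] /andP[w1 w2] dE; apply/negP => /andP[s1 s2].
have lez (x : int) : (`|x| <= M)%N -> `|x| <= M%:Z by lia.
have A := hexagon_area M%:Z _ _ _ _ (lez _ v1) (lez _ v2) (lez _ w1) (lez _ w2) (lez _ s1) (lez _ s2).
rewrite addrC in s1; rewrite addrC in s2.
have B := hexagon_area M%:Z _ _ _ _ (lez _ w1) (lez _ w2) (lez _ v1) (lez _ v2) (lez _ s1) (lez _ s2).
by move: dE A B; rewrite /det2; nia.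
Qed.

(** By Cramer's rule h u = det(u, w) v + det(v, u) w, with both coefficients in {0, h, -h}. So u is
    0, +-v, +-w or +-v +-w; the first is not primitive and the last are outside the box by
    [sum_not_in_box]. *)
Lemma prim_in_box h l M v w u : (M * M < h)%N -> l \in lattices h ->
  v \in box M -> w \in box M -> u \in box M ->
  prim_in h l v -> prim_in h l w -> det2 v w = h%:Z -> prim_in h l u ->
  u \in [:: v; negv v; w; negv w].
Proof.
move=> Mh lh vM wM uM vp wp dE up; have h0 : (0 < h)%N by lia.
have hz : h%:Z != 0 by rewrite eqz_nat -lt0n.
have [vl _] := prim_inP _ _ _ vp; have [wl _] := prim_inP _ _ _ wp.
have [ul _] := prim_inP _ _ _ up.
have A := det2_in_box h l M u w Mh lh uM wM ul wl.
have B := det2_in_box h l M v u Mh lh vM uM vl ul.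
have u1 : h%:Z * u.1 = det2 u w * v.1 + det2 v u * w.1 by rewrite -dE /det2; ring.
have u2 : h%:Z * u.2 = det2 u w * v.2 + det2 v u * w.2 by rewrite -dE /det2; ring.
have nw : negv w \in box M by rewrite box_neg.
have nv : negv v \in box M by rewrite box_neg.
have uE (x y : int) : u.1 = x -> u.2 = y -> u = (x, y) by case: (u) => ? ? /= -> ->.
have habs : `|h%:Z| = h%:Z by [].
rewrite !inE; case: A => eA.
- case: B => eB.
  + by have := prim_in_neq0 _ _ _ h0 up; case/eqP; apply: uE; apply: (mulfI hz);
      rewrite ?u1 ?u2 eA eB; ring.
  + rewrite (_ : u = w) ?eqxx ?orbT //; rewrite [w]surjective_pairing; apply: uE;
      apply: (mulfI hz); rewrite ?u1 ?u2 eA eB; ring.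
  + rewrite (_ : u = negv w) ?eqxx ?orbT //; apply: uE;
      apply: (mulfI hz); rewrite ?u1 ?u2 eA eB; ring.
- case: B => eB.
  + rewrite (_ : u = v) ?eqxx ?orbT //; rewrite [v]surjective_pairing; apply: uE;
      apply: (mulfI hz); rewrite ?u1 ?u2 eA eB; ring.
  + have := sum_not_in_box h M v w Mh vM wM; rewrite dE habs => /(_ erefl).
    rewrite -(uE _ _ _ _) ?uM //; apply: (mulfI hz); rewrite ?u1 ?u2 eA eB; ring.
  + have := sum_not_in_box h M v (negv w) Mh vM nw.
    rewrite (_ : det2 _ _ = - h%:Z) ?normrN ?habs => [/(_ erefl)|]; last first.
      by rewrite -dE /det2 /negv /=; ring.
    rewrite -(uE _ _ _ _) ?uM //; apply: (mulfI hz); rewrite ?u1 ?u2 eA eB /negv /=; ring.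
case: B => eB.
- rewrite (_ : u = negv v) ?eqxx ?orbT //; apply: uE;
    apply: (mulfI hz); rewrite ?u1 ?u2 eA eB; ring.
- have := sum_not_in_box h M (negv v) w Mh nv wM.
  rewrite (_ : det2 _ _ = - h%:Z) ?normrN ?habs => [/(_ erefl)|]; last first.
    by rewrite -dE /det2 /negv /=; ring.
  rewrite -(uE _ _ _ _) ?uM //; apply: (mulfI hz); rewrite ?u1 ?u2 eA eB /negv /=; ring.
- have := sum_not_in_box h M (negv v) (negv w) Mh nv nw.
  rewrite (_ : det2 _ _ = h%:Z) ?habs => [/(_ erefl)|]; last first.
    by rewrite -dE /det2 /negv /=; ring.
  rewrite -(uE _ _ _ _) ?uM //; apply: (mulfI hz); rewrite ?u1 ?u2 eA eB /negv /=; ring.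
Qed.

Lemma pigeonhole {I J : eqType} (s : seq I) (t : seq J) (f : I -> J) :
  uniq s -> {in s, forall x, f x \in t} -> (size t < size s)%N ->
  exists x y, [/\ x \in s, y \in s, x != y & f x = f y].
Proof.
move=> us ft ts; apply: contrapT => ne.
have inj : {in s &, injective f}.
  move=> x y xs ys fxy; apply/eqP; apply/negPn/negP => xy; apply: ne.
  by exists x, y.
have := uniq_leq_size (s1 := map f s) (s2 := t); rewrite map_inj_in_uniq // size_map leqNgt ts => /(_ us).
move=> F; suff: ~~ true by []; by apply: F => _ /mapP[x xs ->]; apply: ft.
Qed.

(** The square [0, K]^2 has more than h points, so two of them are congruent modulo the sublattice.
    Their difference lies in the box, and dividing it by the gcd of its lattice coordinates makes it
    primitive. *)
Lemma prim_in_box_exists h l K : (0 < h)%N -> l \in lattices h -> (h < K.+1 * K.+1)%N ->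
  exists2 v, v \in box K & prim_in h l v.
Proof.
move=> h0 lh hK; have := lh; rewrite mem_lattices // => /andP[ah jl].
set a := l.1 in ah jl *; set j := l.2 in jl; pose d := (h %/ a)%N.
have a0 : (0 < a)%N := dvdn_gt0 h0 ah.
have hE : (d * a = h)%N := divnK ah.
have d0 : (0 < d)%N by case: d hE h0 => // <-.
have az : a%:Z != 0 by rewrite eqz_nat -lt0n.
have dz : d%:Z != 0 by rewrite eqz_nat -lt0n.
(* The class of p modulo the sublattice: subtract floor(p.2 / d) times (j, d), then reduce the first
   coordinate modulo a. There are d * a = h classes. *)
pose f (p : nat * nat) : nat * nat :=
  ((p.2 %% d)%N, `|((p.1%:Z - (p.2 %/ d)%N%:Z * j%:Z) %% a%:Z)%Z|%N).
have [|||p [q [ps qs pq [e1 e2]]]] := @pigeonhole _ _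
    [seq (x, y) | x <- iota 0 K.+1, y <- iota 0 K.+1]
    [seq (x, y) | x <- iota 0 d, y <- iota 0 a] f.
- by apply: allpairs_uniq; rewrite ?iota_uniq // => -[? ?] [? ?].
- move=> p _; apply/allpairsP; exists (f p).
  have m0 : 0 <= ((p.1%:Z - (p.2 %/ d)%N%:Z * j%:Z) %% a%:Z)%Z by rewrite modz_ge0.
  have ma : ((p.1%:Z - (p.2 %/ d)%N%:Z * j%:Z) %% a%:Z)%Z < a%:Z by rewrite ltz_pmod.
  rewrite !mem_iota /f /= !add0n ltn_mod; split => //; lia.
- by rewrite !size_allpairs !size_iota hE.
pose u : int * int := (p.1%:Z - q.1%:Z, p.2%:Z - q.2%:Z).
have pqK (r : nat * nat) : r \in [seq (x, y) | x <- iota 0 K.+1, y <- iota 0 K.+1] ->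
    (r.1 <= K)%N /\ (r.2 <= K)%N.
  by move=> /allpairsP[[x y] []]; rewrite !mem_iota => /andP[_ xK] /andP[_ yK] ->.
have [p1 p2] := pqK _ ps; have [q1 q2] := pqK _ qs.
have uK : u \in box K by rewrite mem_box /u /=; apply/andP; split; lia.
have u0 : u != (0, 0).
  apply: contra_neq pq; rewrite /u => -[x0 y0]; case: (p) (q) x0 y0 => ? ? [? ?] /=.
  by move=> ? ?; congr (_, _); lia.
have ul : in_lat h l u.
  have D1 := divn_eq p.2 d; have D2 := divn_eq q.2 d.
  have D3 := divz_eq (p.1%:Z - (p.2 %/ d)%N%:Z * j%:Z) a%:Z.
  have D4 := divz_eq (q.1%:Z - (q.2 %/ d)%N%:Z * j%:Z) a%:Z.
  have e3 : ((p.1%:Z - (p.2 %/ d)%N%:Z * j%:Z) %% a%:Z)%Z = ((q.1%:Z - (q.2 %/ d)%N%:Z * j%:Z) %% a%:Z)%Z.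
    by move: e2 => /(congr1 Posz); rewrite !gez0_abs ?modz_ge0.
  apply/in_latP => //; rewrite -/a -/j -/d /u /=.
  move: D1 D2 D3 D4; rewrite e1 e3.
  set qp := (p.2 %/ d)%N; set qq := (q.2 %/ d)%N; set r := (_ %% _)%N; set r' := (_ %% _)%Z.
  set s := (_ %/ _)%Z; set s' := (_ %/ _)%Z => D1 D2 D3 D4.
  exists (s - s'), (qp%:Z - qq%:Z); split.
    transitivity ((p.1%:Z - qp%:Z * j%:Z) - (q.1%:Z - qq%:Z * j%:Z) + (qp%:Z - qq%:Z) * j%:Z); first ring.
    by rewrite D3 D4; ring.
  by rewrite D1 D2 !PoszD !PoszM; ring.
have /in_latP-/(_ h0 lh)[s [t [u1 u2]]] := ul.
have [st [e3 e4 [pq' pqE]]] := gcdv_split (s, t).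
set g := gcdv _ in e3 e4; rewrite /= in e3 e4.
have g0 : (0 < g)%N.
  rewrite lt0n; apply: contra_neq u0 => g0.
  by rewrite [u]surjective_pairing u1 u2 e3 e4 g0; congr (_, _); ring.
pose v : int * int := (st.1 * a%:Z + st.2 * j%:Z, st.2 * d%:Z).
have uv1 : u.1 = g%:Z * v.1 by rewrite u1 e3 e4 /v /= -/a -/j; ring.
have uv2 : u.2 = g%:Z * v.2 by rewrite u2 e4 /v /= -/a -/d; ring.
exists v.
  move: uK; rewrite !mem_box uv1 uv2 !abszM => /andP[b1 b2].
  by apply/andP; split; [apply: leq_trans b1|apply: leq_trans b2]; rewrite leq_pmull.
apply/prim_inP; split; first by apply/in_latP => //; exists st.1, st.2.
exists (pq'.1 * a%:Z + pq'.2 * j%:Z, pq'.2 * d%:Z).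
  by apply/in_latP => //; exists pq'.1, pq'.2.
rewrite -hE PoszM -[RHS]mul1r -pqE /det2 /v /=; ring.
Qed.

(** * Bases against primitive vectors in the box *)

Definition nprim (h : nat) (l : nat * nat) (K : nat) : nat :=
  (\sum_(v <- box K) prim_in h l v)%N.

Definition nbases (h : nat) (l : nat * nat) (K : nat) : nat :=
  (\sum_(p <- [seq (v, w) | v <- box K, w <- box K])
     [&& in_lat h l p.1, in_lat h l p.2 & det2 p.1 p.2 == h%:Z])%N.

Lemma four_uniq v w : det2 v w != 0 -> uniq [:: v; negv v; w; negv w].
Proof.
move=> d0; have ne (x y : int * int) : (det2 x y != 0) -> x != y.
  by apply: contra_neq => ->; rewrite /det2; ring.
have v0 : v != (0, 0) by apply: contra_neq d0 => ->; rewrite /det2 /=; ring.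
have w0 : w != (0, 0) by apply: contra_neq d0 => ->; rewrite /det2 /=; ring.
have nE x y : det2 (negv x) y = - det2 x y by rewrite /det2 /negv /=; ring.
have nE' x y : det2 x (negv y) = - det2 x y by rewrite /det2 /negv /=; ring.
rewrite /= !inE !negb_or (eq_sym v (negv v)) (eq_sym w (negv w)) !negv_neq //.
by rewrite !ne ?nE ?nE' ?oppr_eq0.
Qed.

(** If the box of radius M contains a basis v, w, its primitive vectors are +-v, +-w and it has
    exactly 4 bases, so equality holds on the left. If it contains none, its primitive vectors are
    collinear, hence at most 2, while the box of radius M+1 has at least 2. *)
Lemma nprim_nbases h l M : (M * M < h <= M.+1 * M.+1)%N -> l \in lattices h ->
  (2 * nprim h l M <= nbases h l M + 4 <= 2 * nprim h l M.+1)%N.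
Proof.
move=> /andP[Mh hM] lh; have h0 : (0 < h)%N by lia.
have hz : h%:Z != 0 by rewrite eqz_nat -lt0n.
rewrite /nprim /nbases !sum_nat_pred_size.
set s := [seq v <- box M | prim_in h l v]; set s1 := [seq v <- box M.+1 | prim_in h l v].
set t := [seq p <- _ | _].
have us : uniq s by rewrite filter_uniq // box_uniq.
have ut : uniq t.
  by rewrite filter_uniq // allpairs_uniq ?box_uniq // => -[? ?] [? ?].
have ss1 : {subset s <= s1}.
  move=> v; rewrite !mem_filter !mem_box => /andP[-> /andP[v1 v2]].
  by rewrite (leq_trans v1 (leqnSn M)) (leq_trans v2 (leqnSn M)).
have sle : (size s <= size s1)%N by apply: uniq_leq_size.
have tP v w : ((v, w) \in t) = [&& v \in s, w \in s & det2 v w == h%:Z].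
  rewrite !mem_filter; apply/idP/idP.
    case/andP => /and3P[vl wl /eqP dE]; rewrite -[(v, w).1]/v -[(v, w).2]/w in vl wl dE => /allpairsP[q [vM wM [e1 e2]]].
    rewrite -e1 in vM; rewrite -e2 in wM; rewrite vM wM dE eqxx.
    by have /andP[-> ->] := prim_in_pair h l v w h0 lh vl wl dE.
  case/and3P => /andP[/prim_inP[vl _] vM] /andP[/prim_inP[wl _] wM] dE.
  by rewrite vl wl dE; apply/allpairsP; exists (v, w).
have t_le p : p \in t -> size t = 4 /\ size s = 4.
  case: p => v w; rewrite tP => /and3P[vs ws /eqP dE].
  have [vp vM] : prim_in h l v /\ v \in box M by move: vs; rewrite mem_filter => /andP.
  have [wp wM] : prim_in h l w /\ w \in box M by move: ws; rewrite mem_filter => /andP.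
  have nvs : negv v \in s by rewrite mem_filter box_neg vM prim_in_neg.
  have nws : negv w \in s by rewrite mem_filter box_neg wM prim_in_neg.
  have dnz : det2 v w != 0 by rewrite dE.
  have u4 := four_uniq v w dnz.
  have sE : s =i [:: v; negv v; w; negv w].
    move=> u; apply/idP/idP.
      rewrite mem_filter => /andP[up uM]; exact: (prim_in_box h l M).
    by rewrite !inE => /or4P[] /eqP->.
  have sz : size s = 4 by apply: (perm_size (uniq_perm us u4 sE)).
  (* Among the 16 ordered pairs from +-v, +-w, these are the ones of determinant +h. *)
  split=> //; pose t4 := [:: (v, w); (w, negv v); (negv v, negv w); (negv w, v)].
  have hh : (- h%:Z == h%:Z) = false by apply/negbTE/eqP; move: h0; clear; lia.
  have h00 : (0 == h%:Z) = false by rewrite eq_sym; apply/negbTE.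
  have dvv x : det2 x x = 0 by rewrite /det2; ring.
  have nE x y : det2 (negv x) y = - det2 x y by rewrite /det2 /negv /=; ring.
  have nE' x y : det2 x (negv y) = - det2 x y by rewrite /det2 /negv /=; ring.
  have dC : det2 w v = - h%:Z by rewrite -dE /det2; ring.
  have ut4 : uniq t4.
    apply: (@map_uniq _ _ fst); rewrite (perm_uniq (_ : perm_eq _ [:: v; negv v; w; negv w])) //.
    by rewrite perm_cons; apply: (permEl (perm_catCA [:: w] [:: negv v] [:: negv w])).
  apply: (perm_size (uniq_perm ut ut4 _)) => -[x y]; rewrite tP !sE; apply/idP/idP.
    case/and3P; rewrite !inE => /or4P[] /eqP-> /or4P[] /eqP->;
    by rewrite ?nE ?nE' ?dvv ?dC ?dE ?opprK ?oppr0 ?hh ?h00 // ?xpair_eqE ?eqxx ?orbT.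
  rewrite !inE !xpair_eqE => /or4P[] /andP[/eqP-> /eqP->];
  by rewrite ?nE ?nE' ?dC ?dE ?opprK ?eqxx ?orbT.
case E : t => [|p t'].
  have [v vM vp] := prim_in_box_exists h l M.+1 h0 lh ltac:(lia).
  have s1_2 : (2 <= size s1)%N.
    apply: (@uniq_leq_size _ [:: v; negv v]).
      by rewrite /= inE eq_sym negv_neq // (prim_in_neq0 h l).
    by move=> x; rewrite !inE mem_filter => /orP[] /eqP->; rewrite ?box_neg ?vM ?prim_in_neg ?vp.
  have s_2 : (size s <= 2)%N.
    case Es : s => [|x s'] //; rewrite -Es.
    have xs : x \in s by rewrite Es mem_head.
    apply: (@uniq_leq_size _ _ [:: x; negv x]) => // y ys.
    move: (xs) (ys); rewrite !mem_filter => /andP[xp xM] /andP[yp yM].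
    have [xl _] := prim_inP _ _ _ xp; have [yl _] := prim_inP _ _ _ yp.
    have [d0|d1|d2] := det2_in_box h l M x y Mh lh xM yM xl yl.
    - by case: (prim_in_collinear h l x y h0 lh xp yp d0) => ->; rewrite !inE eqxx ?orbT.
    - by have := tP x y; rewrite E in_nil xs ys d1 eqxx.
    have := tP y x; rewrite E in_nil xs ys (_ : det2 y x = h%:Z) ?eqxx //.
    by rewrite -[RHS]opprK -d2 /det2; ring.
  by rewrite /=; lia.
rewrite -E; have [|-> s4] := t_le p; first by rewrite E mem_head.
rewrite s4 in sle *; apply/andP; split=> //.
by rewrite (leq_mul2l 2 4).
Qed.

(** By [sum_lattices_pair], grouping the solutions by the sublattice they span counts each of them
    once. *)
Lemma ndetE h M : (0 < h)%N -> ndet h M = (\sum_(l <- lattices h) nbases h l M)%N.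
Proof.
move=> h0; rewrite exchange_big /=.
transitivity (\sum_(p <- [seq (v, w) | v <- box M, w <- box M]) (det2 p.1 p.2 == h%:Z))%N.
  rewrite [RHS]big_allpairs_dep [RHS]big_allpairs_dep /=.
  apply: eq_bigr => x1 _; apply: eq_bigr => x2 _.
  by rewrite [RHS]big_allpairs_dep.
apply: eq_bigr => -[v w] _ /=; case: eqP => dE.
  transitivity 1%N; first by [].
  by rewrite -(sum_lattices_pair h v w h0 dE); apply: eq_bigr => l _; rewrite andbT.
by rewrite big1 // => l _; rewrite !andbF.
Qed.

(** * Reduction to coprime pairs *)

Lemma sum_prim h K : (0 < h)%N ->
  (\sum_(l <- lattices h) nprim h l K = \sum_(v <- box K | v != (0%R, 0%R)) (gcdv v %| h) * gcdv v)%N.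
Proof.
move=> h0; rewrite exchange_big /= [RHS]big_mkcond /=; apply: eq_bigr => v _.
case: eqP => [->|/eqP v0]; last exact: sum_prim_in.
apply: big1 => l _; apply/eqP; rewrite eqb0; apply/negP => /(prim_in_neq0 _ _ _ h0).
by rewrite eqxx.
Qed.

Definition ncoprime (K : nat) : nat := (\sum_(v <- box K) (gcdv v == 1))%N.

Lemma sum_gcdv_eq K g : (0 < g)%N ->
  (\sum_(v <- box K) (gcdv v == g) = ncoprime (K %/ g))%N.
Proof.
move=> g0; rewrite /ncoprime !sum_nat_pred_size.
pose f (v : int * int) := (g%:Z * v.1, g%:Z * v.2).
have gz : g%:Z != 0 by rewrite eqz_nat -lt0n.
rewrite -[RHS](size_map f); apply: perm_size; apply: uniq_perm.
- by rewrite filter_uniq // box_uniq.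
- rewrite map_inj_uniq ?filter_uniq ?box_uniq // => -[x y] [x' y'] [].
  by move=> /(mulfI gz)-> /(mulfI gz)->.
have gf u : gcdv (f u) = (g * gcdv u)%N by rewrite /gcdv /f /= !abszM muln_gcdr.
have fbox u : (f u \in box K) = (u \in box (K %/ g)).
  by rewrite !mem_box /f /= !abszM !leq_divRL // ![(_ * g)%N]mulnC.
move=> v; rewrite mem_filter; apply/andP/mapP => [[/eqP vg vK]|[u]].
  have [u [u1 u2 _]] := gcdv_split v; rewrite vg in u1 u2.
  have vE : v = f u by rewrite [v]surjective_pairing u1 u2.
  exists u => //; rewrite mem_filter -fbox -vE vK andbT.
  by rewrite -(eqn_pmul2l g0) -gf -vE vg muln1.
by rewrite mem_filter -fbox => /andP[/eqP u1 uK] ->; rewrite gf u1 muln1 eqxx.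
Qed.

Lemma sum_prim_divisors h K : (0 < h)%N ->
  (\sum_(l <- lattices h) nprim h l K = \sum_(g <- divisors h) g * ncoprime (K %/ g))%N.
Proof.
move=> h0; rewrite sum_prim // big_mkcond /=.
transitivity (\sum_(v <- box K) \sum_(g <- divisors h) g * (gcdv v == g))%N.
  apply: eq_bigr => v _; case: eqP => [->|/eqP v0] /=.
    rewrite big_seq big1 // => g; rewrite -dvdn_divisors // => /(dvdn_gt0 h0).
    by case: g => // g _; rewrite (_ : (_ == _) = false) ?muln0.
  case: (boolP (_ %| _)%N) => gh.
    rewrite mul1n (bigD1_seq (gcdv v)) ?divisors_uniq ?(dvdn_divisors, dvdn_divisors) //=.
      rewrite eqxx muln1 big1 ?addn0 // => g; rewrite eq_sym => /negPf->.
      by rewrite muln0.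
    by rewrite -dvdn_divisors.
  rewrite big_seq big1 // => g; rewrite -dvdn_divisors //; case: eqP => [<-|]; last by rewrite muln0.
  by rewrite (negPf gh).
rewrite exchange_big /= big_seq [RHS]big_seq; apply: eq_bigr => g.
rewrite -dvdn_divisors // => /(dvdn_gt0 h0) g0; rewrite -big_distrr /=.
by rewrite sum_gcdv_eq.
Qed.

(** Moebius inversion over the nonzero vectors. With q = floor(K / d), the box has (2q + 1)^2
    vectors divisible by d; the origin, whose gcd 0 is divisible by every d, is removed, leaving
    4q^2 + 4q. *)
Lemma ncoprimeE K : (ncoprime K)%:Z =
  \sum_(1 <= d < K.+1) mobius d * (4 * (K %/ d) ^ 2 + 4 * (K %/ d))%N%:Z.
Proof.
rewrite /ncoprime (big_morph Posz PoszD (erefl _)).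
transitivity (\sum_(v <- box K | v != (0%R, 0%R)) \sum_(1 <= d < K.+1 | (d %| gcdv v)%N) mobius d).
  rewrite [RHS]big_mkcond /=; rewrite big_seq [RHS]big_seq; apply: eq_bigr => v.
  rewrite mem_box => /andP[v1 v2]; have [->|v0] := eqVneq v (0, 0); first by [].
  have g0 : (0 < gcdv v)%N.
    rewrite gcdn_gt0 !absz_gt0; case: (v) v0 => x y; rewrite xpair_eqE negb_and.
    by case/orP => ->; rewrite ?orbT.
  have gK : (gcdv v <= K)%N.
    move: g0; rewrite /gcdv; have [->|n0] := posnP `|v.1|%N; first by rewrite gcd0n.
    by move=> _; apply: leq_trans v1; apply: dvdn_leq (dvdn_gcdl _ _).
  rewrite /=; transitivity ((gcdv v == 1)%N%:R : int); first by case: (_ == _).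
  rewrite -sum_mobius // -[RHS]big_filter.
  apply: perm_big; apply: uniq_perm; rewrite ?divisors_uniq ?filter_uniq ?iota_uniq // => d.
  rewrite mem_filter mem_index_iota -dvdn_divisors // andbC.
  case: (boolP (_ %| _)%N) => dg; rewrite ?andbF // andbT.
  by have := dvdn_leq g0 dg; have := dvdn_gt0 g0 dg; lia.
under eq_bigr do rewrite big_mkcond /=.
rewrite exchange_big /= !big_nat; apply: eq_bigr => d /andP[d0 dK].
under eq_bigr do rewrite -mulrb -mulr_natr.
rewrite -big_distrr /=; congr (_ * _).
have e : (\sum_(v <- box K) (d %| gcdv v) = (2 * (K %/ d) + 1) * (2 * (K %/ d) + 1))%N.
  rewrite -(sum_zrange_dvd K d d0) big_distrlr /= [LHS]big_allpairs_dep /=.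
  apply: eq_bigr => x _; apply: eq_bigr => y _.
  by rewrite /gcdv /= dvdn_gcd; case: (_ %| _)%N => //=; case: (_ %| _)%N.
have z : (0, 0) \in box K by rewrite mem_box.
have := e; rewrite (bigD1_seq (0, 0)) ?box_uniq //= (_ : d %| gcdv (0%R, 0%R))%N; last exact: dvdn0.
move=> e'; transitivity ((\sum_(v <- box K | v != (0%R, 0%R)) (d %| gcdv v))%N%:Z).
  by rewrite (big_morph Posz PoszD (erefl _)); apply: eq_bigr => v _; case: (_ %| _)%N.
congr Posz; move: e'; rewrite -mulnn; move: (\sum_(_ <- _ | _) _)%N (K %/ d)%N => S q; nia.
Qed.

(** * Density of coprime pairs *)

Lemma sum_range_divisors {V : nmodType} (F : nat -> V) n K : (0 < n <= K)%N ->
  \sum_(1 <= k < K.+1 | (k %| n)%N) F k = \sum_(d <- divisors n) F d.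
Proof.
move=> /andP[n0 nK]; rewrite -[LHS]big_filter.
apply: perm_big; apply: uniq_perm; rewrite ?divisors_uniq ?filter_uniq ?iota_uniq // => d.
rewrite mem_filter mem_index_iota -dvdn_divisors //.
case: (boolP (d %| n)%N) => //= dg.
by rewrite (dvdn_gt0 n0 dg) ltnS (leq_trans (dvdn_leq n0 dg)).
Qed.

Lemma sum_range_multiples {V : nmodType} (F : nat -> V) k K : (0 < k)%N ->
  \sum_(1 <= n < K.+1 | (k %| n)%N) F n = \sum_(1 <= m < (K %/ k).+1) F (k * m)%N.
Proof.
move=> k0; rewrite -[LHS]big_filter -[RHS](big_map (muln k) predT F).
apply: perm_big; apply: uniq_perm; rewrite ?filter_uniq ?iota_uniq //.
  by rewrite map_inj_uniq ?iota_uniq // => i j /eqP; rewrite eqn_pmul2l // => /eqP.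
move=> n; rewrite mem_filter mem_index_iota; apply/andP/mapP => [[/dvdnP[m ->]]|[m]].
  rewrite muln_gt0 k0 andbT ltnS => /andP[m0 mK]; exists m; last exact: mulnC.
  by rewrite mem_index_iota m0 ltnS leq_divRL.
rewrite mem_index_iota ltnS leq_divRL // => /andP[m0 mK] ->.
by rewrite dvdn_mulr // muln_gt0 k0 m0 ltnS mulnC.
Qed.

Definition zpart (R : realType) (n : nat) : R := \sum_(1 <= m < n.+1) (m%:R ^+ 2)^-1.
Definition harm (R : realType) (n : nat) : R := \sum_(1 <= k < n.+1) k%:R^-1.

Lemma series_riemannR2 (R : realType) n : series (riemannR (2 : R)) n = zpart R n.
Proof.
rewrite /series /= /zpart big_add1 /=; apply: eq_bigr => i _.
congr (_^-1).
by rewrite -powR_mulrn.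
Qed.

Lemma zpartS (R : realType) n : zpart R n.+1 = zpart R n + (n.+1%:R ^+ 2)^-1.
Proof. by rewrite /zpart big_nat_recr. Qed.

(** Telescoping of 1/(x+1)^2 <= 1/x - 1/(x+1); the last term is kept in the bound so that the
    induction closes. *)
Lemma zpart_tail (R : realType) n k : (0 < n)%N ->
  zpart R n <= zpart R (n + k) <= zpart R n + n%:R^-1 - (n + k)%:R^-1.
Proof.
move=> n0; elim: k => [|k /andP[IH1 IH2]]; first by rewrite addn0 addrK lexx.
rewrite addnS zpartS.
have x0 : 0 < (n + k)%:R :> R by rewrite ltr0n addn_gt0 n0.
have y0 : 0 < (n + k).+1%:R :> R by rewrite ltr0n.
have yE : (n + k).+1%:R = (n + k)%:R + 1 :> R by rewrite -natr1.
apply/andP; split.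
  by apply: le_trans IH1 _; rewrite lerDl invr_ge0 exprn_ge0 // ltW.
have : ((n + k).+1%:R ^+ 2)^-1 <= (n + k)%:R^-1 - (n + k).+1%:R^-1 :> R.
  have -> : (n + k)%:R^-1 - (n + k).+1%:R^-1 = ((n + k)%:R * (n + k).+1%:R)^-1 :> R.
    rewrite yE; field; lra.
  by rewrite lef_pV2 ?posrE ?mulr_gt0 ?exprn_gt0 // expr2 ler_pM2r // ler_nat.
move: IH2; move: ((_ ^+ 2)^-1) ((n + k).+1%:R^-1) ((n + k)%:R^-1) (n%:R^-1).
by move: (zpart R n) (zpart R (n + k)) => *; lra.
Qed.

Lemma zeta2_bounds (R : realType) n : (0 < n)%N ->
  zpart R n <= zeta (2 : R) <= zpart R n + n%:R^-1.
Proof.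
move=> n0; set u := series (riemannR (2 : R)).
have nd : nondecreasing_seq u.
  by apply/nondecreasing_seqP => m; rewrite /u !series_riemannR2 zpartS lerDl invr_ge0 exprn_ge0.
have ub m : u m <= zpart R n + n%:R^-1.
  rewrite /u series_riemannR2; have [mn|/ltnW nm] := leqP m n.
    have := nd _ _ mn; rewrite /u !series_riemannR2 => /le_trans; apply.
    by rewrite lerDl invr_ge0.
  rewrite -(subnKC nm); have /andP[_ /le_trans] := zpart_tail R n (m - n) n0; apply.
  by rewrite gerBl invr_ge0.
have cu : cvgn u by apply: nondecreasing_is_cvgn => //; exists (zpart R n + n%:R^-1) => _ [m _ <-].
rewrite /zeta -/u; apply/andP; split.
  by rewrite -series_riemannR2; apply: nondecreasing_cvgn_le.
by apply: limr_le => //; near=> m; apply: ub.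
Unshelve. all: by end_near. Qed.

Lemma zeta2_ge1 (R : realType) : 1 <= zeta (2 : R).
Proof.
have /andP[+ _] := zeta2_bounds R 1 isT.
by rewrite /zpart big_nat1 expr1n invr1.
Qed.

(** A truncated form of zeta(2) * sum mu(k)/k^2 = 1. The cutoff floor(K / k) makes n = k m run over
    all n <= K, so the identity is exact and only n = 1 survives. *)
Lemma mobius_zpart (R : realType) K : (0 < K)%N ->
  \sum_(1 <= k < K.+1) (mobius k)%:~R / k%:R ^+ 2 * zpart R (K %/ k) = 1.
Proof.
move=> K0.
transitivity (\sum_(1 <= k < K.+1) \sum_(1 <= n < K.+1 | (k %| n)%N) (mobius k)%:~R * (n%:R ^+ 2)^-1 : R).
  rewrite !big_nat; apply: eq_bigr => k /andP[k0 _].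
  rewrite sum_range_multiples // /zpart mulr_sumr; apply: eq_bigr => m _.
  by rewrite natrM exprMn [in RHS]invfM mulrA.
under eq_bigr do rewrite big_mkcond /=.
rewrite exchange_big /=.
transitivity (\sum_(1 <= n < K.+1) (n == 1)%N%:R : R).
  rewrite big_nat [RHS]big_nat; apply: eq_bigr => n nK.
  rewrite -big_mkcond /= -mulr_suml sum_range_divisors //.
  rewrite -(big_morph intr (@intrD R) (mulr0z 1)) sum_mobius; last by case/andP: nK.
  by have [->|] := eqVneq n 1%N; rewrite ?mul0r // expr1n invr1 mulr1.
rewrite big_ltn // big_nat big1 ?addr0 // => n /andP[n1 _].
by rewrite (gtn_eqF n1).
Qed.

Lemma mobius_norm (R : realType) k : `|(mobius k)%:~R : R| <= 1.
Proof. by rewrite -intr_norm -[X in _ <= X]/(1%:~R) ler_int normr_mobius_le1. Qed.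

(** Subtracting the exact identity [mobius_zpart] leaves the tails of zeta(2) beyond floor(K / k),
    each at most 2k/K; weighted by 1/k^2 they sum to (2/K) sum 1/k. *)
Lemma mobius_zeta (R : realType) K : (0 < K)%N ->
  `| zeta (2 : R) * (\sum_(1 <= k < K.+1) (mobius k)%:~R / k%:R ^+ 2) - 1 |
    <= 2 * harm R K / K%:R.
Proof.
move=> K0; rewrite -[X in _ - X](mobius_zpart R K K0) mulr_sumr -sumrB.
apply: le_trans (ler_norm_sum _ _ _) _; rewrite /harm mulr_sumr mulr_suml.
rewrite !big_nat; apply: ler_sum => k /andP[k0 kK].
have kR : 0 < k%:R :> R by rewrite ltr0n.
have KR : 0 < K%:R :> R by rewrite ltr0n.
have q0 : (0 < K %/ k)%N by rewrite divn_gt0.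
have qR : 0 < (K %/ k)%:R :> R by rewrite ltr0n.
rewrite -(mulrC (_ / _)) -mulrBr !normrM [ `|_^-1|]ger0_norm ?invr_ge0 ?exprn_ge0 //.
have /andP[z1 z2] := zeta2_bounds R (K %/ k) q0.
rewrite [ `|zeta _ - _|]ger0_norm ?subr_ge0 //.
have b1 : zeta (2 : R) - zpart R (K %/ k) <= 2 * k%:R / K%:R.
  (* With q = floor(K / k) >= 1, one has K < (q + 1) k <= 2 q k. *)
  have : (K %/ k)%:R^-1 <= 2 * k%:R / K%:R :> R.
    rewrite ler_pdivlMr // ler_pdivrMl // mulrA -natrM -natrM ler_nat.
    by have := ltn_ceil K k0; nia.
  lra.
apply: (@le_trans _ _ (1 / k%:R ^+ 2 * (2 * k%:R / K%:R))).
  apply: ler_pM => //; rewrite ?mulr_ge0 ?invr_ge0 ?exprn_ge0 ?subr_ge0 //.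
  by rewrite ler_pM2r ?invr_gt0 ?exprn_gt0 // mobius_norm.
rewrite le_eqVlt; apply/orP; left; apply/eqP; field; lra.
Qed.

Lemma harm_ge0 (R : realType) n : 0 <= harm R n.
Proof. by apply: sumr_ge0 => k _; rewrite invr_ge0. Qed.

Lemma harm_le (R : realType) m n : (m <= n)%N -> harm R m <= harm R n.
Proof.
move=> mn; rewrite /harm [X in _ <= X](big_cat_nat (n := m.+1)) //= lerDl.
by apply: sumr_ge0 => k _; rewrite invr_ge0.
Qed.

Lemma ncoprime_asymp (R : realType) K :
  `| (ncoprime K)%:R - 4 * K%:R ^+ 2 / zeta (2 : R) | <= 16 * K%:R * harm R K.
Proof.
have [->|K0] := posnP K.
  have := ncoprimeE 0; rewrite big_geq // => -[->].
  by rewrite expr0n /= !(mulr0, mul0r) subrr normr0.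
have z1 := zeta2_ge1 R; set z := zeta _ in z1 *.
have KR : 0 < K%:R :> R by rewrite ltr0n.
set S := \sum_(1 <= k < K.+1) (mobius k)%:~R / k%:R ^+ 2 : R.
(* The error 16 splits in two halves: [A] replaces 4q^2 + 4q by 4 (K/k)^2 at a cost of 8K/k per
   term, and [C] replaces the finite Moebius sum by 1 / zeta(2). *)
have A : `|(ncoprime K)%:R - 4 * K%:R ^+ 2 * S| <= 8 * K%:R * harm R K.
  rewrite -[(ncoprime K)%:R]/((ncoprime K)%:Z%:~R) ncoprimeE.
  rewrite (big_morph intr (@intrD R) (mulr0z 1)) mulr_sumr -sumrB.
  apply: le_trans (ler_norm_sum _ _ _) _; rewrite /harm mulr_sumr.
  rewrite !big_nat; apply: ler_sum => k /andP[k0 kK].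
  have kR : 0 < k%:R :> R by rewrite ltr0n.
  set q := (K %/ k)%N; have q0 : (0 < q)%N by rewrite divn_gt0.
  have q1 : (q * k <= K)%N by apply: leq_divM.
  have q2 : (K < q.+1 * k)%N by apply: ltn_ceil.
  rewrite intrM -pmulrn natrD !natrM.
  have -> : (mobius k)%:~R * (4 * (q%:R * q%:R) + 4 * q%:R) - 4 * K%:R ^+ 2 * ((mobius k)%:~R / k%:R ^+ 2)
     = (mobius k)%:~R * (4 * (q%:R ^+ 2 + q%:R - (K%:R / k%:R) ^+ 2)) :> R.
    by field; lra.
  rewrite normrM; apply: (@le_trans _ _ (1 * (8 * (K%:R / k%:R)))); last by rewrite mul1r mulrA.
  apply: ler_pM => //; first exact: mobius_norm.
  set t : R := K%:R / k%:R.
  have t1 : q%:R <= t by rewrite ler_pdivlMr // -natrM ler_nat.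
  have t2 : t <= q%:R + 1 by rewrite natr1 ler_pdivrMr // -natrM ler_nat ltnW.
  have q3 : 1 <= q%:R :> R by rewrite ler1n.
  rewrite ler_norml; apply/andP; split; nra.
have B := mobius_zeta R K K0; rewrite -/z -/S in B.
have C : `|4 * K%:R ^+ 2 * S - 4 * K%:R ^+ 2 / z| <= 8 * K%:R * harm R K.
  have -> : 4 * K%:R ^+ 2 * S - 4 * K%:R ^+ 2 / z = (4 * K%:R ^+ 2 / z) * (z * S - 1).
    by field; lra.
  have c0 : 0 <= 4 * K%:R ^+ 2 / z by rewrite divr_ge0 ?mulr_ge0 ?exprn_ge0 //; lra.
  rewrite normrM ger0_norm //.
  apply: (@le_trans _ _ (4 * K%:R ^+ 2 * (2 * harm R K / K%:R))).
    apply: ler_pM => //; rewrite ler_pdivrMr; last by lra.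
    by rewrite ler_peMr // mulr_ge0 ?exprn_ge0.
  rewrite le_eqVlt; apply/orP; left; apply/eqP; field; lra.
apply: le_trans (ler_distD (4 * K%:R ^+ 2 * S) _ _) _.
by apply: le_trans (lerD A C) _; rewrite -mulrDl -mulrDl -natrD.
Qed.

(** * Asymptotics *)

(* Counts the pairs (v, L) with v in the box of radius K primitive in L. *)
Definition nprim_total (h K : nat) : nat := (\sum_(g <- divisors h) g * ncoprime (K %/ g))%N.
Definition inv_sum (R : realType) (h : nat) : R := \sum_(d <- divisors h) d%:R^-1.

Lemma ndet_nprim_total h M : (M * M < h <= M.+1 * M.+1)%N ->
  (2 * nprim_total h M <= ndet h M + 4 * (\sum_(d <- divisors h) d) <= 2 * nprim_total h M.+1)%N.
Proof.
move=> hM; have h0 : (0 < h)%N by case/andP: hM => /(leq_ltn_trans (leq0n _)).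
rewrite /nprim_total -!sum_prim_divisors // ndetE // -[X in (4 * X)%N]size_lattices.
have -> : (4 * size (lattices h) = \sum_(l <- lattices h) 4)%N.
  by rewrite big_const_seq iter_addn_0 count_predT.
rewrite -big_split /= !big_distrr /=.
apply/andP; split; rewrite big_seq [X in (_ <= X)%N]big_seq.
  by apply: leq_sum => l lh; have /andP[] := nprim_nbases h l M hM lh.
by apply: leq_sum => l lh; have /andP[] := nprim_nbases h l M hM lh.
Qed.

(** The divisor g contributes about g * 4 (K/g)^2 / zeta(2). Its error is g times that of
    [ncoprime_asymp] at q = floor(K/g), plus at most 8K for replacing q^2 by (K/g)^2. *)
Lemma nprim_total_asymp (R : realType) h K : (0 < h)%N ->
  `| (nprim_total h K)%:R - 4 / zeta (2 : R) * inv_sum R h * K%:R ^+ 2 |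
    <= (ndiv h)%:R * (16 * K%:R * harm R K + 8 * K%:R).
Proof.
move=> h0; rewrite /nprim_total natr_sum /inv_sum mulr_sumr mulr_suml -sumrB.
apply: le_trans (ler_norm_sum _ _ _) _.
set E := 16 * _ * _ + _.
have -> : (ndiv h)%:R * E = \sum_(g <- divisors h) E.
  by rewrite big_const_seq iter_addr_0 count_predT mulr_natl.
rewrite big_seq [X in _ <= X]big_seq; apply: ler_sum => g; rewrite -dvdn_divisors // => gh.
have g0 : (0 < g)%N := dvdn_gt0 h0 gh.
have gR : 0 < g%:R :> R by rewrite ltr0n.
have z1 := zeta2_ge1 R; have nc := ncoprime_asymp R (K %/ g).
set z := zeta _ in z1 nc *; set q := (K %/ g)%N in nc *.
have q1 : (q * g <= K)%N by apply: leq_divM.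
have q2 : (K < q.+1 * g)%N by apply: ltn_ceil.
have hq : harm R q <= harm R K by apply: harm_le; apply: leq_div.
have hq0 := harm_ge0 R q.
pose t : R := K%:R / g%:R.
have t1 : q%:R <= t by rewrite ler_pdivlMr // -natrM ler_nat.
have t2 : t <= q%:R + 1 by rewrite natr1 ler_pdivrMr // -natrM ler_nat ltnW.
have q0 : 0 <= q%:R :> R by [].
have KE : K%:R = t * g%:R by rewrite divfK // gt_eqF.
have -> : (g * ncoprime q)%:R - 4 / z * g%:R^-1 * K%:R ^+ 2 =
   g%:R * ((ncoprime q)%:R - 4 * q%:R ^+ 2 / z) + g%:R * (4 / z * (q%:R ^+ 2 - t ^+ 2)) :> R.
  by rewrite natrM KE; field; lra.
apply: le_trans (ler_normD _ _) _; apply: lerD.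
  rewrite normrM [ `|g%:R|]ger0_norm; last exact: ltW.
  have -> : 16 * K%:R * harm R K = g%:R * (16 * t * harm R K) by rewrite KE; ring.
  rewrite ler_pM2l //; apply: le_trans nc _; apply: ler_pM => //.
  by rewrite ler_pM2l.
rewrite normrM [ `|g%:R|]ger0_norm; last exact: ltW.
have -> : 8 * K%:R = g%:R * (8 * t) by rewrite KE; ring.
rewrite ler_pM2l //.
have zi : 0 <= 4 / z <= 4.
  by rewrite divr_ge0 //= ?ler_pdivrMr; lra.
have a1 : `|q%:R ^+ 2 - t ^+ 2| <= 2 * t.
  rewrite ler_norml; apply/andP; split; nra.
rewrite normrM ger0_norm; last by case/andP: zi.
have : 4 / z * `|q%:R ^+ 2 - t ^+ 2| <= 4 * (2 * t).
  by apply: ler_pM => //; case/andP: zi.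
lra.
Qed.

(** * Power bounds for harmonic sums and the divisor function *)

Lemma harm_powR (R : realType) (e : R) : 0 < e ->
  exists2 C : R, 0 < C & forall n, (0 < n)%N -> harm R n <= C * n%:R `^ e.
Proof.
(* The constant comes from harm n <= 1 + ln n and ln n = ln(n^e) / e <= n^e / e. *)
move=> e0; exists (1 + e^-1); first by rewrite addr_gt0 ?invr_gt0.
have hln n : harm R n.+1 <= 1 + ln n.+1%:R.
  elim: n => [|n IH]; first by rewrite /harm big_nat1 invr1 ln1 addr0.
  rewrite /harm big_nat_recr //= -/(harm R n.+1).
  have n0 : 0 < n.+1%:R :> R by rewrite ltr0n.
  have m0 : 0 < n.+2%:R :> R by rewrite ltr0n.
  have mE : n.+2%:R = n.+1%:R + 1 :> R by rewrite -natr1.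
  have : ln (1 + - n.+2%:R^-1) <= - n.+2%:R^-1 :> R.
    by apply: le_ln1Dx; rewrite ltrN2 invf_lt1 // mE ltrDr.
  have -> : 1 + - n.+2%:R^-1 = n.+1%:R / n.+2%:R :> R by rewrite mE; field; lra.
  rewrite ln_div ?posrE // => l1.
  apply: le_trans (lerD IH (lexx _)) _; move: l1.
  by move: (ln n.+1%:R) (ln n.+2%:R) (n.+2%:R^-1) => a b c; lra.
case=> // n _; apply: le_trans (hln n) _.
have n1 : 1 <= n.+1%:R :> R by rewrite ler1n.
have p1 : 1 <= n.+1%:R `^ e :> R by rewrite -[X in X <= _](powRr0 n.+1%:R) ler_powR // ltW.
rewrite mulrDl mul1r; apply: lerD => //.
have -> : ln n.+1%:R = e^-1 * ln (n.+1%:R `^ e) :> R.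
  by rewrite ln_powR mulrA mulVf ?mul1r // gt_eqF.
by rewrite ler_pM2l ?invr_gt0 // ltW // ln_sublinear // (lt_le_trans ltr01).
Qed.

Lemma bernoulli_ineq (R : realType) (x : R) n : 0 <= x -> 1 + x *+ n <= (1 + x) ^+ n.
Proof.
move=> x0; elim: n => [|n IH]; first by rewrite mulr0n addr0 expr0.
rewrite exprS mulrSr; apply: le_trans (ler_wpM2l _ IH); last by lra.
rewrite mulrDl mul1r mulrDr mulr1.
have : 0 <= x * (x *+ n) by rewrite mulr_ge0 // mulrn_wge0.
lra.
Qed.

(* Only finitely many primes p have p `^ d < 2, and each of them costs a bounded factor A. *)
Lemma ndiv_powR (R : realType) (d : R) : 0 < d ->
  exists2 C : R, 0 < C & forall n, (0 < n)%N -> (ndiv n)%:R <= C * n%:R `^ d.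
Proof.
move=> d0; pose x : R := 2 `^ d - 1.
have x0 : 0 < x.
  have l2 : 1 <= 2 `^ d :> R by rewrite -[X in X <= _](powRr0 2) ler_powR ?ler1n // ltW.
  rewrite subr_gt0 lt_neqAle l2 andbT eq_sym powR_eq1 !negb_or (gt_eqF d0) -leNgt ler0n.
  by rewrite gt_eqF // ltr1n.
(* Chosen so that e + 1 <= A (1 + x e), which is at most A (2^d)^e by Bernoulli's inequality: a
   prime power p^e costs at most the factor A. *)
pose A : R := 1 + x^-1.
have A1 : 1 <= A by rewrite lerDl invr_ge0 ltW.
have A0 : 0 < A by lra.
have hA e : e.+1%:R <= A * (2 `^ d) ^+ e.
  have := bernoulli_ineq R x e (ltW x0); rewrite (_ : 1 + x = 2 `^ d); last by rewrite /x; lra.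
  move=> b; apply: le_trans (ler_wpM2l (ltW A0) b).
  rewrite -natr1 /A -[x *+ e]mulr_natr; have -> : (1 + x^-1) * (1 + x * e%:R) = 1 + e%:R + x * e%:R + x^-1 by field; lra.
  have : 0 <= x * e%:R by rewrite mulr_ge0 // ltW.
  have : 0 < x^-1 by rewrite invr_gt0.
  lra.
pose P := Num.bound (2 `^ d^-1 : R).
have hP p : (P <= p)%N -> 2 <= p%:R `^ d :> R.
  move=> Pp; have c0 : 0 <= 2 `^ d^-1 :> R by apply: powR_ge0.
  have : 2 `^ d^-1 <= p%:R :> R.
    apply: le_trans (_ : P%:R <= p%:R); last by rewrite ler_nat.
    by apply: ltW; apply: archi_boundP.
  move=> le; have := @ge0_ler_powR R d (ltW d0) _ _ _ _ le.
  rewrite -powRrM mulVf ?gt_eqF // powRr1 //; apply; rewrite nnegrE //.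
(* Induction on a strict bound k for the prime factors of n. The exponent of A stops growing at P,
   since only primes below P may cost a factor. *)
have key k : forall n, (0 < n)%N -> (forall p, prime p -> (p %| n)%N -> (p < k)%N) ->
   (ndiv n)%:R <= A ^+ (minn k P) * n%:R `^ d.
  elim: k => [|k IH] n n0 hn.
    have [->|n1] := eqVneq n 1%N.
      by rewrite min0n expr0 mul1r powR1.
    have n2 : (1 < n)%N by lia.
    by have := hn _ (pdiv_prime n2) (pdiv_dvd n).
  have Amin : A ^+ (minn k P) <= A ^+ (minn k.+1 P).
    by apply: ler_weXn2l => //; rewrite leq_min geq_minr andbT (leq_trans (geq_minl _ _)).
  case: (boolP (prime k && (k %| n)%N)) => [/andP[kp kn]|nk]; last first.
    apply: le_trans (IH n n0 _) _; last by rewrite ler_wpM2r // powR_ge0.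
    move=> p pp pn; have := hn p pp pn; rewrite ltnS leq_eqVlt => /orP[/eqP pk|//].
    by move: nk; rewrite -pk pp pn.
  have [m cop nE] := pfactor_coprime kp n0; set e := logn k n in nE.
  have m0 : (0 < m)%N by move: n0; rewrite nE muln_gt0 => /andP[].
  have ke0 : (0 < k ^ e)%N by rewrite expn_gt0 prime_gt0.
  have hm : (ndiv m)%:R <= A ^+ (minn k P) * m%:R `^ d.
    apply: IH => // p pp pm; have := hn p pp; rewrite nE dvdn_mulr // => /(_ isT).
    rewrite ltnS leq_eqVlt => /orP[/eqP pk|//].
    by move: cop; rewrite prime_coprime // -pk pm.
  (* For k >= P the inequality e + 1 <= 2^e <= (k^d)^e needs no new factor; for k < P one factor A
     is spent through [hA]. *)
  have he : e.+1%:R * A ^+ (minn k P) <= A ^+ (minn k.+1 P) * (k%:R `^ d) ^+ e.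
    have [Pk|kP] := leqP P k.
      rewrite (minn_idPr (leqW Pk)) mulrC ler_pM2l ?exprn_gt0 //.
      apply: (@le_trans _ _ (2 ^+ e)); first by rewrite -natrX ler_nat ltn_expl.
      by apply: lerXn2r; rewrite ?nnegrE ?powR_ge0 // hP.
    rewrite (minn_idPl kP) exprS mulrAC ler_pM2r ?exprn_gt0 //.
    apply: le_trans (hA e) _; rewrite ler_pM2l //.
    apply: lerXn2r; rewrite ?nnegrE ?powR_ge0 //.
    by apply: (@ge0_ler_powR R d (ltW d0)); rewrite ?nnegrE ?ler_nat // prime_gt1.
  have -> : n%:R `^ d = m%:R `^ d * (k%:R `^ d) ^+ e :> R.
    rewrite nE natrM powRM // natrX; congr (_ * _).
    by rewrite -[k%:R ^+ e]powR_mulrn // powRAC powR_mulrn // powR_ge0.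
  apply: (@le_trans _ _ ((ndiv m)%:R * e.+1%:R)).
    by rewrite -natrM ler_nat -(ndiv_primeX k e kp) nE ndivM_le.
  apply: (@le_trans _ _ (A ^+ (minn k P) * m%:R `^ d * e.+1%:R)); first by rewrite ler_wpM2r.
  have P1 (a f b : R) : a * f * b = f * (b * a) by ring.
  by rewrite P1 [X in _ <= X]mulrCA ler_wpM2l // powR_ge0.
exists (A ^+ P); first exact: exprn_gt0.
move=> n n0; apply: le_trans (key n.+1 n n0 _) _.
  by move=> p _ /(dvdn_leq n0); rewrite ltnS.
rewrite ler_wpM2r ?powR_ge0 //; apply: ler_weXn2l => //; exact: geq_minr.
Qed.

(** * The asymptotic formula with an explicit error *)

Lemma T_ndet h N : T h N = ndet h N.
Proof.
pose f (p : (int * int) * (int * int)) : int * int * int * int := (p.1.1, p.1.2, p.2.1, p.2.2).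
pose t := [seq p <- [seq (v, w) | v <- box N, w <- box N] | det2 p.1 p.2 == h%:Z].
have ut : uniq t.
  by rewrite filter_uniq // allpairs_uniq ?box_uniq // => -[? ?] [? ?].
have finj : injective f by move=> [[? ?] [? ?]] [[? ?] [? ?]] [-> -> -> ->].
have uf : uniq (map f t) by rewrite map_inj_uniq.
have Tt : T h N = size (map f t).
  have zP (x : int) : (- N%:Z <= x <= N%:Z) = (`|x| <= N)%N by lia.
  have -> : size (map f t) = #|` [fset x in map f t]%fset| by rewrite card_fseq undup_id.
  rewrite /T; congr #|` _|; apply/fsetP => -[[[x y] z] w].
  rewrite in_fset_set; last exact: finite_det_solutions.
  rewrite inE; apply/idP/idP.
    rewrite inE => -[dE]; rewrite !zP => x1 y1 z1 w1.
    apply/mapP; exists ((x, y), (z, w)) => //; rewrite mem_filter; apply/andP; split.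
      by rewrite /det2 /= dE.
    apply/allpairsP; exists ((x, y), (z, w)).
    by split; rewrite // mem_box; apply/andP.
  case/mapP => p; rewrite mem_filter => /andP[/eqP dE].
  move=> /allpairsP[q [q1 q2 pE]]; rewrite pE in dE *.
  move: q1 q2; rewrite !mem_box => /andP[xN yN] /andP[zN wN] [-> -> -> ->].
  by rewrite inE; split; rewrite ?zP.
rewrite Tt size_map -sum_nat_pred_size.
rewrite [LHS]big_allpairs_dep [LHS]big_allpairs_dep /ndet.
apply: eq_bigr => x1 _; apply: eq_bigr => x2 _.
by rewrite [LHS]big_allpairs_dep.
Qed.

(** The map d -> h / d permutes the divisors of h. *)
Lemma sum_divisors_inv (R : realType) h : (0 < h)%N ->
  (\sum_(d <- divisors h) d)%N%:R = h%:R * inv_sum R h.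
Proof.
move=> h0; rewrite natr_sum /inv_sum mulr_sumr.
have pE : perm_eq (divisors h) [seq (h %/ d)%N | d <- divisors h].
  have hK d : d \in divisors h -> (h %/ (h %/ d) = d)%N.
    by rewrite -dvdn_divisors // => /divnA->; rewrite mulKn.
  apply: uniq_perm; rewrite ?divisors_uniq //.
    by rewrite map_inj_in_uniq ?divisors_uniq // => x y /hK {2}<- /hK {2}<- ->.
  move=> d; apply/idP/mapP => [dh|[k]].
    exists (h %/ d)%N; last by rewrite hK.
    by move: dh; rewrite -!dvdn_divisors // => dh; apply/dvdnP; exists d; rewrite mulnC divnK.
  by rewrite -!dvdn_divisors // => kh ->; apply/dvdnP; exists k; rewrite mulnC divnK.
rewrite (perm_big _ pE) /= big_map big_seq [RHS]big_seq; apply: eq_bigr => d.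
rewrite -dvdn_divisors // => dh.
have d0 : d%:R != 0 :> R by rewrite pnatr_eq0 -lt0n (dvdn_gt0 h0 dh).
by apply: (mulIf d0); rewrite divfK // -natrM divnK.
Qed.

Lemma inv_sum_bounds (R : realType) h : (0 < h)%N -> 0 <= inv_sum R h <= (ndiv h)%:R.
Proof.
move=> h0; rewrite /inv_sum sumr_ge0 /= => [|d _]; last by rewrite invr_ge0.
have -> : (ndiv h)%:R = \sum_(g <- divisors h) (1 : R).
  by rewrite big_const_seq iter_addr_0 count_predT.
rewrite big_seq [X in _ <= X]big_seq; apply: ler_sum => d.
rewrite -dvdn_divisors // => /(dvdn_gt0 h0) d0.
by rewrite invf_le1 ?ltr0n // ler1n.
Qed.

Lemma exists_sqrt h : (0 < h)%N -> exists M : nat, (M * M < h <= M.+1 * M.+1)%N.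
Proof.
elim: h => // -[_ _|h IH _]; first by exists 0%N.
have [M /andP[M1 M2]] := IH isT.
have [e|ne] := eqVneq h.+1 (M.+1 * M.+1)%N; first by exists M.+1; lia.
by exists M; lia.
Qed.

Lemma ndet_asymp (R : realType) h N : (1 <= h <= 2 * N ^ 2)%N ->
  `| (ndet h N)%:R - (8 / zeta (2 : R) - 4) * inv_sum R h * N%:R ^+ 2 |
   <= 416 * (ndiv h)%:R * (`|h%:R - N%:R ^+ 2| + N%:R * harm R (2 * N)).
Proof.
move=> /andP[h0 hN]; have [M hM] := exists_sqrt h h0.
have /andP[hM1 hM2] := hM.
have N0 : (0 < N)%N by case: N hN => //; lia.
(* This follows from M^2 < h <= 2 N^2 and lets [harm R (2 * N)] serve for both radii M and M+1. *)
have MN : (M.+1 <= 2 * N)%N by rewrite ltnNge; apply/negP => MN; nia.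
have z1 := zeta2_ge1 R; set z := zeta _ in z1 *.
have /andP[S0 S1] := inv_sum_bounds R h h0; set S := inv_sum R h in S0 S1 *.
set t : R := (ndiv h)%:R in S1 *; set D : R := `|h%:R - N%:R ^+ 2|.
pose H := harm R (2 * N).
have H1 : 1 <= H.
  apply: le_trans (_ : harm R 1 <= H); first by rewrite /harm big_nat1 invr1.
  by apply: harm_le; lia.
have n1 : 1 <= N%:R :> R by rewrite ler1n.
have t0 : 0 <= t by apply: le_trans S1.
have D0 : 0 <= D := normr_ge0 _.
set n : R := N%:R in n1 *.
have mE : M.+1%:R = M%:R + 1 :> R by rewrite natr1.
have m0 : 0 <= M%:R :> R by [].
have mn : M%:R + 1 <= 2 * n by rewrite -mE -natrM ler_nat.
have h1 : M%:R ^+ 2 <= h%:R :> R by rewrite expr2 -natrM ler_nat ltnW.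
have h2 : h%:R <= (M%:R + 1) ^+ 2 :> R by rewrite -mE expr2 -natrM ler_nat.
have d1 : h%:R - n ^+ 2 <= D := ler_norm _.
have d2 : - D <= h%:R - n ^+ 2 by rewrite lerNl /D -normrN ler_norm.
(* The larger radius times the difference of the radii is at most |M^2 - n^2|. Since h - M^2 lies
   between 0 and 2M + 1 <= 4n, this is at most D + 4n. *)
have shell : `|(ndet h N)%:R - (ndet h M)%:R| <= 72 * t * (D + 4 * n).
  have [NM|/ltnW MN'] := leqP N M.
    have /andP[a1 a2] := ndet_le h N M h0 NM.
    rewrite distrC ger0_norm ?subr_ge0 ?ler_nat //.
    rewrite lerBlDl; move: a2; rewrite -(@ler_nat R) => /le_trans; apply.
    rewrite natrD lerD2l !natrM -/t natrB // -/n.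
    have le : M%:R * (M%:R - n) <= D + 4 * n by nra.
    by have := ler_wpM2l t0 le; lra.
  have /andP[a1 a2] := ndet_le h M N h0 MN'.
  rewrite ger0_norm ?subr_ge0 ?ler_nat //.
  rewrite lerBlDl; move: a2; rewrite -(@ler_nat R) => /le_trans; apply.
  rewrite natrD lerD2l !natrM -/t natrB // -/n.
  have le : n * (n - M%:R) <= D + 4 * n.
    have : M%:R <= n by rewrite ler_nat.
    nra.
  by have := ler_wpM2l t0 le; lra.
have := ndet_nprim_total h M hM => /andP[b1 b2].
have {}b1 : 2 * (nprim_total h M)%:R <= (ndet h M)%:R + 4 * (h%:R * S).
  by rewrite /S -sum_divisors_inv // -!natrM -natrD ler_nat.
have {}b2 : (ndet h M)%:R + 4 * (h%:R * S) <= 2 * (nprim_total h M.+1)%:R.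
  by rewrite /S -sum_divisors_inv // -!natrM -natrD ler_nat.
(* The constant is 48 = 2 * (16 + 8), from K <= 2n and H >= 1. *)
have w (K : nat) : K%:R <= 2 * n ->
   `| (nprim_total h K)%:R - 4 / z * S * K%:R ^+ 2 | <= t * (48 * n * H).
  move=> Kn; apply: le_trans (nprim_total_asymp R h K h0) _.
  rewrite -/t ler_wpM2l //.
  have KN : (K <= 2 * N)%N by rewrite -(@ler_nat R) natrM.
  have hK : harm R K <= H := harm_le R _ _ KN.
  have hK0 := harm_ge0 R K; have k0 : 0 <= K%:R :> R by [].
  have : K%:R * harm R K <= 2 * n * H by apply: ler_pM.
  nra.
have cz : 0 <= 4 / z <= 4 by rewrite divr_ge0 //= ?ler_pdivrMr; lra.
(* The primitive counts cost 2 * 48 t n H, replacing their squared radius by n^2 costs 2 * 4 t (D +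
   4n), and replacing 4 h S by 4 S n^2 costs 4 t D. *)
have : `|(ndet h M)%:R - (8 / z - 4) * S * n ^+ 2| <= 12 * t * D + 32 * t * n + 96 * t * n * H.
  have w1 := w M _; have {w1}/ler_normlP[w1 _] : `| (nprim_total h M)%:R - 4 / z * S * M%:R ^+ 2 | <= t * (48 * n * H).
    by apply: w1; lra.
  have /ler_normlP[_ w2] : `| (nprim_total h M.+1)%:R - 4 / z * S * M.+1%:R ^+ 2 | <= t * (48 * n * H).
    by apply: w; rewrite mE.
  rewrite mE in w2; have e : 8 / z = 2 * (4 / z) by field; lra.
  rewrite e; move: (4 / z) cz w1 w2 => c /andP[c0 c4] w1 w2.
  have u0 : 0 <= c * S by apply: mulr_ge0.
  have u4 : c * S <= 4 * t by apply: ler_pM.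
  have p1 : (M%:R + 1) ^+ 2 - n ^+ 2 <= D + 4 * n by lra.
  have p2 : - (D + 4 * n) <= M%:R ^+ 2 - n ^+ 2 by lra.
  have v0 : 0 <= D + 4 * n by lra.
  have r1 : c * S * ((M%:R + 1) ^+ 2 - n ^+ 2) <= 4 * t * (D + 4 * n).
    apply: le_trans (ler_wpM2l u0 p1) _; by apply: ler_wpM2r.
  have r2 : c * S * - (D + 4 * n) <= c * S * (M%:R ^+ 2 - n ^+ 2) by apply: ler_wpM2l.
  have r3 : c * S * (D + 4 * n) <= 4 * t * (D + 4 * n) by apply: ler_wpM2r.
  have r4 : `|S * (h%:R - n ^+ 2)| <= t * D.
    by rewrite normrM ger0_norm //; apply: ler_pM.
  have /ler_normlP[r5 r6] := r4.
  rewrite ler_norml; apply/andP; split; lra.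
move=> inner; apply: le_trans (ler_distD (ndet h M)%:R _ _) _.
apply: le_trans (lerD shell inner) _.
(* After n <= n H the coefficient of t n H is 4 * 72 + 32 + 96 = 416, which exceeds the coefficient
   72 + 12 of t D. *)
have : t * n <= t * (n * H) by rewrite ler_wpM2l // ler_peMr //; lra.
have : 0 <= t * D by apply: mulr_ge0.
rewrite -/H; lra.
Qed.

Theorem theorem1p3 (R : realType) (eps : R) (heps : 0 < eps) :
  exists C : R, 0 < C /\
    forall h N : nat, (1 <= h <= 2 * N ^ 2)%N ->
      let Delta : R := h%:R - N%:R ^+ 2 in
      `| (T h N)%:R
         - (8 / zeta (2 : R) - 4) * (\sum_(d <- divisors h) d%:R^-1)
           * N%:R ^+ 2 |
      <= C * (N%:R `^ (1 + eps) + N%:R `^ eps * `|Delta|).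
Proof.
(* Each of the divisor function and the harmonic sum may cost (2N)^(eps/2). For the former the
   exponent is eps/4, because h is only bounded by (2N)^2. *)
have e2 : 0 < eps / 2 by rewrite divr_gt0.
have e4 : 0 < eps / 2 / 2 by rewrite divr_gt0.
have [C1 C1_gt0 hC1] := ndiv_powR R _ e4; have [C2 C2_gt0 hC2] := harm_powR R _ e2.
pose c : R := 2 `^ (eps / 2).
have c0 : 0 < c by apply: powR_gt0.
have K0 : 0 < 416 :> R by rewrite ltr0n.
move: (ndet_asymp R) K0; move: (416 : R) => K hK K0.
exists (K * (C1 * c) * (1 + C2 * c)); split.
  by rewrite !mulr_gt0 // addr_gt0 // mulr_gt0.
move=> h N hN /=; rewrite T_ndet; apply: le_trans (hK h N hN) _.
have /andP[h0 hN2] := hN.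
have N0 : (0 < N)%N by case: (N) hN2 => //; lia.
have n1 : 1 <= N%:R :> R by rewrite ler1n.
have n0 : 0 <= N%:R :> R by [].
set D := `|_|; have D0 : 0 <= D := normr_ge0 _.
pose a : R := N%:R `^ (eps / 2).
have a1 : 1 <= a by rewrite -[X in X <= _](powRr0 N%:R) ler_powR // ltW.
have c2N : (2 * N)%:R `^ (eps / 2) = c * a :> R by rewrite natrM powRM.
have tau : (ndiv h)%:R <= C1 * (c * a).
  apply: le_trans (hC1 h h0) _; rewrite ler_pM2l // -c2N.
  have -> : (2 * N)%:R `^ (eps / 2) = ((2 * N) ^ 2)%N%:R `^ (eps / 2 / 2) :> R.
    by rewrite natrX -powR_mulrn // -powRrM; congr (_ `^ _); field.
  apply: (@ge0_ler_powR R _ (ltW e4)); rewrite ?nnegrE ?ler_nat //.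
  by move: hN2; clear; rewrite expnMn; lia.
have hH : harm R (2 * N) <= C2 * (c * a).
  by rewrite -c2N; apply: hC2; rewrite muln_gt0.
have aE : N%:R `^ eps = a * a :> R.
  rewrite /a -powRD; last by rewrite (gt_eqF (lt_le_trans ltr01 n1)) implybT.
  by congr (_ `^ _); field.
have aE1 : N%:R `^ (1 + eps) = N%:R * (a * a) :> R.
  by rewrite powRD ?powRr1 ?aE // (gt_eqF (lt_le_trans ltr01 n1)) implybT.
rewrite aE aE1; set n : R := N%:R in n1 n0 *.
have H0 := harm_ge0 R (2 * N).
(* D is weakened to D * a so that, after multiplication by the divisor bound, both terms carry a * a
   = N^eps. *)
have b1 : D + n * harm R (2 * N) <= D * a + n * (C2 * (c * a)).
  by apply: lerD; [rewrite ler_peMr | rewrite ler_wpM2l].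
have b2 : (ndiv h)%:R * (D + n * harm R (2 * N)) <= C1 * (c * a) * (D * a + n * (C2 * (c * a))).
  by apply: ler_pM => //; rewrite addr_ge0 // mulr_ge0.
rewrite -mulrA; apply: (@le_trans _ _ (K * (C1 * (c * a) * (D * a + n * (C2 * (c * a)))))).
  by rewrite ler_pM2l.
have -> : K * (C1 * (c * a) * (D * a + n * (C2 * (c * a)))) =
   K * (C1 * c) * (a * a * D + (C2 * c) * (n * (a * a))) by ring.
rewrite -!mulrA ler_pM2l // !mulrA.
have u0 : 0 <= C1 * c by rewrite mulr_ge0 // ltW.
have v0 : 0 <= C2 * c by rewrite mulr_ge0 // ltW.
have w0 : 0 <= a * a by rewrite mulr_ge0 // ltW // (lt_le_trans ltr01).
rewrite -!(mulrA (C1 * c)); apply: ler_wpM2l => //.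
have x0 : 0 <= n * (a * a) by rewrite mulr_ge0.
have y0 : 0 <= a * a * D by rewrite mulr_ge0.
rewrite -!mulrA in x0 y0 *; rewrite !mulrA in x0 y0 *.
have z0 : 0 <= C2 * c * (a * a * D) by apply: mulr_ge0.
lra.
Qed.
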